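(* There exist universal constants $C,C'>0$ such that the following holds. Let $n\ge 1$, $0<\sigma_{\min}\le\sigma_{\max}<\infty$, $\mu\in\mathbb{R}$, and let $\sigma_1,\dots,\sigma_n\in[\sigma_{\min},\sigma_{\max}]$. Let $X_1,\dots,X_n$ be independent with $X_i\sim\mathcal{N}(\mu,\sigma_i^2)$, let $G_n=\frac1n\sum_{i=1}^n\delta_{\sigma_i}$, and let $\widehat{\mu}^{\mathrm{EB}}=\widehat\mu$ be the $\mu$-component of the joint MLE $$(\widehat\mu,\widehat G)\in\operatorname*{arg\,max}_{\mu'\in\mathbb{R},\ \operatorname{supp}(G)\subseteq[\sigma_{\min},\sigma_{\max}]}\ \frac1n\sum_{i=1}^n\log f_{\mu',G}(X_i).$$ Then for every $\delta\in(0,1)$, with probability at least $1-\delta$, $$|\widehat\mu^{\mathrm{EB}}-\mu|\le C\,\omega_{H^2,G_n}\!\left(\frac{C'}{n}\left[\log^3\!\Big(\frac{n\sigma_{\max}}{\sigma_{\min}}\Big)\Big(\log\log\Big(\frac{n\sigma_{\max}}{\sigma_{\min}}\Big)\Big)^4+\log\frac1\delta\right]\right),$$ where $$\omega_{H^2,G}(t)=\sup\{|\mu_1-\mu_2|:\ \mu_1,\mu_2\in\mathbb{R},\ H^2(f_{\mu_1,G},f_{\mu_2,G})\le t\}.$$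
   Context: For $\mu\in\mathbb{R}$ and a probability distribution $G$ on $(0,\infty)$, $f_{\mu,G}(x)=\mathbb{E}_{\sigma\sim G}\big[\frac1\sigma\varphi\big(\frac{x-\mu}{\sigma}\big)\big]$, where $\varphi$ is the standard normal density. The squared Hellinger distance between densities is $H^2(p,q)=\int(\sqrt p-\sqrt q)^2\,dx$ (no factor $1/2$). In the maximization, $G$ ranges over all probability distributions supported on $[\sigma_{\min},\sigma_{\max}]$, and $(\widehat\mu,\widehat G)$ is any maximizer. The supremum defining $\omega_{H^2,G}(t)$ may be $+\infty$. Convention: the quantities $\log(n\sigma_{\max}/\sigma_{\min})$ and $\log\log(n\sigma_{\max}/\sigma_{\min})$ are read as $\max\{1,\cdot\}$ of themselves. *)

(* Defs.v *)
From HB Require Import structures.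
From mathcomp Require Import all_boot all_order all_algebra.
From mathcomp Require Import all_classical all_reals all_analysis.
From mathcomp Require Import measurable_realfun.

Set Implicit Arguments.
Unset Strict Implicit.
Unset Printing Implicit Defensive.

Import Order.TTheory GRing.Theory Num.Theory.
Import numFieldTopology.Exports.

Local Open Scope classical_set_scope.
Local Open Scope ring_scope.

Section gaussian_scale_mixtures.
Context {R : realType}.
Implicit Types (G : {measure set R -> \bar R}) (m x t : R) (p q : R -> R).

(* [normal_pdf 0 1] is the standard normal density. The expectation is cut down
   to the positive scales, which is no restriction for G carried by ]0, +oo[. *)
Definition mixture_density m G x : R :=
  \int[G]_(s in `]0, +oo[%classic) (s^-1 * normal_pdf 0 1 ((x - m) / s)).

(* Squared Hellinger distance, without the factor 1/2. *)
Definition hellinger2 p q : \bar R :=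
  (\int[lebesgue_measure]_x ((Num.sqrt (p x) - Num.sqrt (q x)) ^+ 2)%:E)%E.

(* The supremum is taken in the extended reals, where it may be +oo. *)
Definition hellinger_modulus G t : \bar R :=
  ereal_sup [set (`|m.1 - m.2|)%:E | m in
    [set m : R * R |
      (hellinger2 (mixture_density m.1 G) (mixture_density m.2 G) <= t%:E)%E]].

Definition topological_support G : set R :=
  [set s | forall U : set R, open U -> U s -> (0 < G U)%E].

Lemma topological_support_itvP (G : probability R R) (a b : R) :
  topological_support G `<=` `[a, b]%classic <-> G `[a, b]%classic = 1%E.
Proof.
have mab : measurable (`[a, b]%classic : set R) by exact: measurable_itv.
have GC : G (~` `[a, b]%classic) = 0%E <-> G `[a, b]%classic = 1%E.
  split=> [GC0|G1]; last by rewrite probability_setC// G1 subee.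
  rewrite -[X in G X]setCK probability_setC//; last exact: measurableC.
  by rewrite GC0 sube0.
have oC : open (~` `[a, b]%classic : set R).
  by apply: closed_openC; exact: itv_closed.
rewrite -GC; split=> [sab|G0 s sG]; last first.
  by apply: contrapT => nsab; have /gt_eqF/eqP := sG _ oC nsab; apply.
pose F (k : nat) : set R :=
  if (unpickle k : option (rat * rat)) is Some (p, q) then
    if G `](ratr p), (ratr q)[%classic == 0%E
    then `](ratr p), (ratr q)[%classic else set0
  else set0.
apply/negligibleP; first exact: measurableC.
apply: (@negligibleS _ _ _ _ (\bigcup_k F k)); last first.
  apply: negligible_bigcup => k; rewrite /F.
  case: unpickle => [[p q]|]; last exact: negligible_set0.
  by case: eqP => [G0|_]; [exact/negligibleP|exact: negligible_set0].
move=> x nx.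
have /existsNP[U /not_implyP[oU /not_implyP[Ux /negP]]] :
  ~ topological_support G x by move/sab.
rewrite -leNgt => GU0.
have /nbhs_ballP[e /= e0 xeU] : nbhs x U by exact: open_nbhs_nbhs.
have [p] : exists p : rat, ratr p \in `]x - e, x[ by apply: rat_in_itvoo; rewrite ltrBlDr ltrDl.
rewrite in_itv/= => /andP[xp px].
have [q] : exists q : rat, ratr q \in `]x, x + e[ by apply: rat_in_itvoo; rewrite ltrDl.
rewrite in_itv/= => /andP[xq qx].
exists (pickle (p, q)); [exact: I|rewrite /F pickleK].
suff -> : G `](ratr p), (ratr q)[%classic == 0%E by rewrite /= in_itv/= px xq.
rewrite eq_le measure_ge0 andbT (le_trans _ GU0)//; apply: le_measure.
- by rewrite inE; exact: measurable_itv.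
- by rewrite inE; exact: open_measurable.
move=> y /=; rewrite in_itv/= => /andP[py yq]; apply: xeU.
rewrite /ball/= ltr_distlC; apply/andP; split.
  exact: lt_trans py.
exact: (lt_trans yq).
Qed.

Definition empirical_measure n (sigma : 'I_n -> R) (A : set R) : \bar R :=
  ((n%:R^-1)%:E * \sum_(i < n) \d_(sigma i) A)%E.

Section empirical_measure_is_measure.
Variables (n : nat) (sigma : 'I_n -> R).

Let tau (k : nat) : {measure set R -> \bar R} :=
  if insub k is Some i then \d_(sigma i) else mzero.

Let inv_ge0 : 0 <= n%:R^-1 :> R. Proof. by rewrite invr_ge0. Qed.

Let empirical_measureE :
  empirical_measure sigma = mscale (NngNum inv_ge0) (msum tau n).
Proof.
apply/funext => A; rewrite /empirical_measure /mscale /msum /=; congr (_ * _)%E.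
by apply: eq_bigr => i _; rewrite /tau valK.
Qed.

Let empirical_measure0 : empirical_measure sigma set0 = 0%E.
Proof. by rewrite empirical_measureE measure0. Qed.

Let empirical_measure_ge0 A : (0 <= empirical_measure sigma A)%E.
Proof. by rewrite empirical_measureE. Qed.

Let empirical_measure_sigma_additive :
  semi_sigma_additive (empirical_measure sigma).
Proof.
by rewrite empirical_measureE; exact: measure_semi_sigma_additive.
Qed.

HB.instance Definition _ := isMeasure.Build _ _ _ (empirical_measure sigma)
  empirical_measure0 empirical_measure_ge0 empirical_measure_sigma_additive.

Lemma empirical_measure_setT :
  (0 < n)%N -> empirical_measure sigma [set: R] = 1%E.
Proof.
move=> n0; rewrite /empirical_measure.
under eq_bigr do rewrite diracT.
by rewrite sumEFin sumr_const card_ord -EFinM mulVf// pnatr_eq0 -lt0n.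
Qed.

End empirical_measure_is_measure.

Definition log_likelihood n (x : 'I_n -> R) m G : R :=
  n%:R^-1 * \sum_(i < n) ln (mixture_density m G (x i)).

Definition is_joint_mle (smin smax : R) n (x : 'I_n -> R)
    (m : R) (G : probability R R) : Prop :=
  topological_support G `<=` `[smin, smax]%classic /\
  forall (m' : R) (G' : probability R R),
    topological_support G' `<=` `[smin, smax]%classic ->
    log_likelihood x m' G' <= log_likelihood x m G.

End gaussian_scale_mixtures.

Section probability_notions.
Context d (T : measurableType d) (R : realType) (P : probability T R).

Definition mutually_independent n (X : 'I_n -> {RV P >-> R}) : Prop :=
  forall (J : {set 'I_n}) (B : 'I_n -> set R),
    (forall i, measurable (B i)) ->
    P (\bigcap_(i in [set` J]) X i @^-1` B i) =
    (\prod_(i in J) P (X i @^-1` B i))%E.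

(* The laws are compared on Borel sets only: a measure is unconstrained, and
   [distribution] therefore meaningless, on other sets. *)
Definition normally_distributed (X : {RV P >-> R}) (m s : R) : Prop :=
  forall B : set R, measurable B -> distribution P X B = normal_prob m s B.

(* The event E has inner probability at least r; for a measurable E this is
   r <= P E. Needed for events that involve an arbitrary, possibly
   non-measurable, selection of a maximizer. *)
Definition holds_with_probability_ge (E : set T) (r : R) : Prop :=
  exists A : set T, [/\ measurable A, A `<=` E & (r%:E <= P A)%E].

Lemma holds_with_probability_geE (E : set T) (r : R) : measurable E ->
  holds_with_probability_ge E r <-> (r%:E <= P E)%E.
Proof.
move=> mE; split=> [[A [mA AE rA]]|rE]; last by exists E; split.
by apply: (le_trans rA); apply: le_measure; rewrite ?inE.
Qed.

End probability_notions.

(* Main.v *)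
From HB Require Import structures.
Require Import Defs.
From mathcomp Require Import all_boot all_order all_algebra.
From mathcomp Require Import all_classical all_reals all_analysis.
From mathcomp Require Import measurable_realfun.
From mathcomp Require Import ring lra.

Set Implicit Arguments.
Unset Strict Implicit.
Unset Printing Implicit Defensive.

Import Order.TTheory GRing.Theory Num.Theory.
Import numFieldTopology.Exports.

Local Open Scope classical_set_scope.
Local Open Scope ring_scope.

(** Write [f] for the mixture located at [mu] with the empirical mixing measure of
    the scales, [n] for the number of observations, [a] and [b] for the bounds on
    the scales.

    Deterministic part. A scale mixture of centred Gaussians is symmetric about
    its location. If the fitted mixture, located at [m'], is close to [f] in
    Hellinger distance, then so is it to the mirror image of [f] about [m'],
    which is the mixture with the same mixing measure located at [2 m' - mu]. By
    the triangle inequality [mu] and [2 m' - mu] compete in the modulus, and they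
    are [2 |m' - mu|] apart ([location_le_hellinger_modulus]). It remains to show
    that the squared Hellinger distance of the fitted mixture to [f] is at most a
    constant times [(ln (n b / a) ^ 3 + ln (1 / delta)) / n] with probability at
    least [1 - delta].

    Probabilistic part. The fitted mixture has at least the likelihood of [f].
    For a fixed function [g], the probability that the likelihood of [g] is at
    least that of [f] is, by Markov's inequality for the square root of the
    likelihood ratio and by independence, at most a product of [n] integrals,
    one for each observation. Their arithmetic mean is the affinity
    [\int sqrt (g f)], because [f] is the average of the densities of the
    observations, so the product is at most the [n]-th power of this affinity
    ([likelihood_le_probability]). When [g] is a density at squared Hellinger
    distance [t] from [f], the affinity is [1 - t / 2].

    Entropy part. To cover all mixtures by finitely many functions [g], a code
    with finitely many values is attached to each of them, such that mixtures
    with equal codes differ by at most a small envelope ([mixture_code]); the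
    envelope changes the affinity by at most [1 / n]. On a block of scales with
    ratio [e], the kernel [s^-1 phi ((x - m) / s)] is, up to a prescribed error,
    a polynomial in [s^-1] whose degree is linear in the logarithm of the inverse
    error, or negligible when [x] is far from [m] ([exp_truncation]). Hence a
    mixture is determined, up to this error, by its location and by the integrals
    of these monomials over the blocks, and the code consists of rounded values
    of both. There are of the order of [ln (n b / a)] blocks, as many monomials on
    each, and each rounded integral has a number of values whose logarithm is of
    the same order: this is the cube of the logarithm in the statement. *)

(** * Integrals of functions of independent random variables *)

Section weighted_transfer.
Local Open Scope ereal_scope.
Context d d' (T : measurableType d) (S : measurableType d') (R : realType).
Variables (mu : {measure set T -> \bar R}) (nu : {measure set S -> \bar R}).
Variables (X : T -> S) (W : T -> R) (V : S -> R).
Hypotheses (mX : measurable_fun setT X) (mW : measurable_fun setT W)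
  (mV : measurable_fun setT V).
Hypotheses (W0 : forall x, (0 <= W x)%R) (V0 : forall y, (0 <= V y)%R).
Hypothesis WV : forall B, measurable B ->
  \int[mu]_x (W x * \1_B (X x))%:E = \int[nu]_y (V y * \1_B y)%:E.

Import HBNNSimple.

Let transfer_nnsfun (f : {nnsfun S >-> R}) :
  \int[mu]_x (W x * f (X x))%:E = \int[nu]_y (V y * f y)%:E.
Proof.
have mB (r : R) : measurable (f @^-1` [set r]) by [].
have mI r : measurable_fun setT (fun x => \1_(f @^-1` [set r]) (X x) : R).
  exact: (measurableT_comp (measurable_indic (mB r))).
have sumE (w : R) y : (0 <= w)%R -> (w * f y)%:E =
    \sum_(r \in range f) (w * (r * \1_(f @^-1` [set r]) y))%:E.
  move=> w0; rewrite fimfunE EFinM -fsumEFin// ge0_mule_fsumr//.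
  by move=> r; rewrite nnfun_muleindic_ge0.
under eq_integral do rewrite sumE//.
under [RHS]eq_integral do rewrite sumE//.
have pos (r w : R) y : (0 <= w)%R ->
    0 <= (w * (r * \1_(f @^-1` [set r]) y))%:E.
  by move=> w0; rewrite EFinM mule_ge0// nnfun_muleindic_ge0.
rewrite !ge0_integral_fsum//=; last 4 first.
- by move=> r; apply/measurable_EFinP; do 2 apply: measurable_funM => //.
- by move=> r x _; exact: pos.
- by move=> r; apply/measurable_EFinP; do 2 apply: measurable_funM => //.
- by move=> r x _; exact: pos.
apply: eq_fsbigr => r _; have [r0|r0] := ltP r 0%R.
  rewrite preimage_nnfun0// indic0.
  by rewrite !integral0_eq// => x _; rewrite !mulr0.
under eq_integral do rewrite mulrCA EFinM.
under [RHS]eq_integral do rewrite mulrCA EFinM.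
rewrite !ge0_integralZl//= ?WV//.
- by apply/measurable_EFinP; exact: measurable_funM.
- by move=> x _; rewrite lee_fin mulr_ge0.
- by apply/measurable_EFinP; exact: measurable_funM.
- by move=> x _; rewrite lee_fin mulr_ge0.
Qed.

(** Both sides are monotone limits along simple functions below [f], and the
    hypothesis is the case of an indicator function. *)
Lemma ge0_integral_weighted_transfer (f : S -> R) :
  measurable_fun setT f -> (forall y, (0 <= f y)%R) ->
  \int[mu]_x (W x * f (X x))%:E = \int[nu]_y (V y * f y)%:E.
Proof.
move=> mf f0.
have mEf : measurable_fun setT (EFin \o f) by exact/measurable_EFinP.
have f0' y : setT y -> 0 <= (EFin \o f) y by rewrite /= lee_fin.
pose g := nnsfun_approx measurableT mEf.
have fE (w : R) y : (w * f y)%:E = limn (fun k => (w * g k y)%:E).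
  apply/esym/cvg_lim => //; rewrite EFinM.
  by under eq_fun do rewrite EFinM; apply: cvgeZl => //; exact: cvg_nnsfun_approx.
have nd (w : R) y : (0 <= w)%R ->
    {homo (fun k => (w * g k y)%:E) : m n / (m <= n)%N >-> m <= n}.
  move=> w0 m n mn; rewrite lee_fin ler_wpM2l//.
  exact/lefP/nd_nnsfun_approx.
under eq_integral do rewrite fE.
under [RHS]eq_integral do rewrite fE.
rewrite !monotone_convergence//.
- by under eq_fun do rewrite transfer_nnsfun.
- move=> n; apply/measurable_EFinP; exact: measurable_funM.
- by move=> n x _; rewrite lee_fin mulr_ge0.
- by move=> x _; exact: nd.
- move=> n; apply/measurable_EFinP; apply: measurable_funM => //.
  exact: measurableT_comp.
- by move=> n x _; rewrite lee_fin mulr_ge0.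
- by move=> x _; exact: nd.
Qed.

End weighted_transfer.

Section independent_densities.
Local Open Scope ereal_scope.
Context d (T : measurableType d) (R : realType) (P : probability T R).
Variables (n : nat) (X : 'I_n -> {RV P >-> R}) (p : 'I_n -> R -> R).
Hypothesis indep : mutually_independent X.
Hypotheses (mp : forall i, measurable_fun setT (p i))
  (p0 : forall i x, (0 <= p i x)%R).
Hypothesis density : forall i (B : set R), measurable B ->
  P (X i @^-1` B) = \int[lebesgue_measure]_(x in B) (p i x)%:E.

Let E (phi : 'I_n -> R -> R) i :=
  \int[lebesgue_measure]_x (p i x * phi i x)%:E.

Let density_indic i (B : set R) : measurable B ->
  \int[lebesgue_measure]_x (p i x * \1_B x)%:E = P (X i @^-1` B).
Proof.
move=> mB; rewrite density// [RHS]integral_mkcond; apply: eq_integral => x _.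
by rewrite patchE indicE; case: ifP => _; rewrite ?mulr1 ?mulr0.
Qed.

Let product_of_indicators (B : 'I_n -> set R) : (forall i, measurable (B i)) ->
  \int[P]_w (\prod_(i < n) \1_(B i) (X i w))%:E =
  \prod_(i < n) E (fun i => \1_(B i)) i.
Proof.
move=> mB; have mXB i : measurable (X i @^-1` B i).
  by rewrite -[X in measurable X]setTI; exact: measurable_funPT.
transitivity (P (\bigcap_(i in [set` [set: 'I_n]%SET]) X i @^-1` B i)).
  rewrite -[X in P X]setIT -integral_indic//; last first.
    by apply: fin_bigcap_measurable => // i _; exact: mXB.
  apply: eq_integral => w _; congr (_%:E); rewrite [RHS]indicE.
  have [wB|wB] := boolP (w \in _).
    rewrite big1// => i _; rewrite indicE mem_set//.
    by move: wB; rewrite inE => /(_ i); apply; rewrite /= inE.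
  have [/forallP wB'|] := boolP [forall i, (X i w \in B i)].
    move/negP: wB; case; rewrite inE => i _ /=.
    by have := wB' i; rewrite inE.
  rewrite negb_forall => /existsP[i wi]; rewrite (bigD1 i)//=.
  by rewrite indicE (negbTE wi) mul0r.
rewrite indep//; under eq_bigl do rewrite inE.
by apply: eq_bigr => i _; rewrite /E density_indic.
Qed.

(** Indicator functions are replaced one coordinate at a time: with the other
    factors absorbed into a weight on the sample space, the new factor is an
    instance of [ge0_integral_weighted_transfer]. *)
Lemma expectation_prod_independent (phi : 'I_n -> R -> R) :
  (forall i, measurable_fun setT (phi i)) -> (forall i x, (0 <= phi i x)%R) ->
  (forall i, \int[lebesgue_measure]_x (p i x * phi i x)%:E < +oo) ->
  \int[P]_w (\prod_(i < n) phi i (X i w))%:E =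
  \prod_(i < n) \int[lebesgue_measure]_x (p i x * phi i x)%:E.
Proof.
suff H k (psi : 'I_n -> R -> R) :
    (forall i, measurable_fun setT (psi i)) -> (forall i x, (0 <= psi i x)%R) ->
    (forall i, E psi i < +oo) ->
    (forall i : 'I_n, (k <= i)%N ->
       exists2 B : set R, measurable B & psi i = \1_B) ->
    \int[P]_w (\prod_(i < n) psi i (X i w))%:E = \prod_(i < n) E psi i.
  move=> mphi phi0 phioo; apply: (H n) => // i; by rewrite leqNgt ltn_ord.
elim: k psi => [|k IH] psi mpsi psi0 psioo indic_psi.
  have /choice[B HB] i : exists B : set R, measurable B /\ psi i = \1_B.
    by have [B mB psiB] := indic_psi i isT; exists B.
  have -> : psi = fun i => \1_(B i) by apply/funext => i; have [] := HB i.
  by apply: product_of_indicators => i; have [] := HB i.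
have [kn|nk] := ltnP k n; last first.
  apply: IH => // i ki; exfalso.
  by have := leq_trans nk ki; rewrite leqNgt ltn_ord.
pose i0 := Ordinal kn.
pose c : R := fine (\prod_(i < n | i != i0) E psi i).
have E0 (f : 'I_n -> R -> R) i : (forall x, (0 <= f i x)%R) -> 0 <= E f i.
  by move=> f0; apply: integral_ge0 => x _; rewrite lee_fin mulr_ge0.
have cE : \prod_(i < n | i != i0) E psi i = c%:E.
  rewrite fineK//; elim/big_ind : _ => //; first exact: fin_numM.
  by move=> i _; rewrite ge0_fin_numE// E0.
have c0 : (0 <= c)%R.
  by rewrite -lee_fin -cE; apply: prode_ge0 => i _; exact: E0.
pose W w := (\prod_(i < n | i != i0) psi i (X i w))%R.
pose V x := (c * p i0 x)%R.
transitivity (\int[lebesgue_measure]_x (V x * psi i0 x)%:E); last first.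
  rewrite (bigD1 i0)//= cE muleC -ge0_integralZl//=.
  - by apply: eq_integral => x _; rewrite -EFinM mulrA.
  - by apply/measurable_EFinP; exact: (measurable_funM (mp i0) (mpsi i0)).
  - by move=> x _; rewrite lee_fin mulr_ge0.
rewrite -(@ge0_integral_weighted_transfer _ _ _ (measurableTypeR R) R P
  lebesgue_measure (X i0) W)//; last exact: (mpsi i0).
- by apply: eq_integral => w _; rewrite (bigD1 i0)//= mulrC.
- exact: (measurable_funPT (X i0)).
- rewrite (_ : W = fun w => \prod_(i < n)
      (if i != i0 then psi i (X i w) else 1))%R; last first.
    by apply/funext => w; rewrite /W big_mkcond.
  apply: measurable_prod => i _; case: (i != i0) => //.
  exact: measurableT_comp.
- exact: (measurable_funM (measurable_cst _) (mp i0)).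
- by move=> w; apply: prodr_ge0.
- by move=> x; rewrite mulr_ge0.
move=> B mB.
pose psiB i := if i == i0 then \1_B else psi i : R -> R.
have psiB0 i x : (0 <= psiB i x)%R by rewrite /psiB; case: ifP.
have psiBE i : i != i0 -> psiB i = psi i by rewrite /psiB => /negbTE ->.
transitivity (\int[P]_w (\prod_(i < n) psiB i (X i w))%:E).
  apply: eq_integral => w _; congr (_%:E); rewrite [RHS](bigD1 i0)//=.
  rewrite mulrC; congr (_ * _)%R; first by rewrite /psiB eqxx.
  by apply: eq_bigr => i ii0; rewrite psiBE.
have EpsiB i : i != i0 -> E psiB i = E psi i.
  by move=> ii0; rewrite /E; under eq_integral do rewrite psiBE//.
rewrite IH//.
- rewrite (bigD1 i0)//=.
  rewrite (eq_bigr _ EpsiB).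
  rewrite cE muleC /E /psiB eqxx -ge0_integralZl//=.
  + by apply: eq_integral => x _; rewrite -EFinM mulrA.
  + apply/measurable_EFinP.
    exact: (measurable_funM (mp i0) (measurable_indic mB)).
  + by move=> x _; rewrite lee_fin mulr_ge0.
- by move=> i; rewrite /psiB; case: ifP.
- move=> i; have [->|/EpsiB ->//] := eqVneq i i0.
  rewrite /E /psiB eqxx density_indic//.
  by rewrite (le_lt_trans (probability_le1 _ _)) ?ltry// -[X in measurable X]setTI; exact: measurable_funPT.
- move=> i ki; have [->|ii0] := eqVneq i i0.
    by exists B => //; rewrite /psiB eqxx.
  rewrite psiBE//; apply: indic_psi; rewrite ltn_neqAle ki andbT.
  by apply: contra_neq ii0 => ki'; apply: val_inj.
Qed.

End independent_densities.

(** * Gaussian scale mixtures *)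

Section gaussian_kernel.
Context {R : realType}.
Implicit Types (a b m x s v : R) (G : probability R R).

Local Notation peak := (normal_peak (1 : R)).

Lemma std_normal_pdfE v : normal_pdf 0 1 v = peak * expR (- (v ^+ 2 / 2)).
Proof.
rewrite normal_pdfE ?oner_neq0// /normal_fun; congr (_ * expR _).
by rewrite expr1n subr0 mulNr.
Qed.

Lemma std_normal_pdfN v : normal_pdf 0 1 (- v) = normal_pdf 0 1 v.
Proof. by rewrite 2!std_normal_pdfE sqrrN. Qed.

Lemma peak_bounds : 3^-1 <= peak <= 1.
Proof.
have pi4 : (pi : R) < 4 by have := @pihalf_lt2 R; lra.
have pi2 := @pi_ge2 R.
rewrite /normal_peak; set r := Num.sqrt _.
have r2 : r ^+ 2 = 2 * pi by rewrite sqr_sqrtr expr1n; lra.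
have r0 : 0 <= r by exact: sqrtr_ge0.
have r1 : 1 <= r by nra.
have r3 : r <= 3 by nra.
by rewrite lef_pV2 ?posrE ?r3 ?invf_le1//; lra.
Qed.

Let peak_gt0 : 0 < peak. Proof. by have /andP[] := peak_bounds; lra. Qed.

Lemma normal_pdf_scale m s x : 0 < s ->
  s^-1 * normal_pdf 0 1 ((x - m) / s) = normal_pdf m s x.
Proof.
move=> s0; rewrite std_normal_pdfE normal_pdfE ?gt_eqF// /normal_fun mulrA.
congr (_ * expR _); last by field; exact: lt0r_neq0.
rewrite /normal_peak -invfM; congr (_^-1).
by rewrite expr1n mul1r -mulrnAr sqrtrM ?sqr_ge0// sqrtr_sqr gtr0_norm.
Qed.

(** The factor [\1_`[a, b]] makes the kernel bounded and jointly measurable on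
    the whole plane without changing the mixtures of interest. *)
Definition scale_kernel a b m x s : R :=
  \1_`[a, b] s * (s^-1 * normal_pdf 0 1 ((x - m) / s)).

Lemma scale_kernel_in a b m x s : a <= s <= b ->
  scale_kernel a b m x s = s^-1 * normal_pdf 0 1 ((x - m) / s).
Proof.
by move=> sab; rewrite /scale_kernel indicE mem_set ?mul1r//= in_itv.
Qed.

Lemma scale_kernel_out a b m x s : ~~ (a <= s <= b) ->
  scale_kernel a b m x s = 0.
Proof.
move=> sab; rewrite /scale_kernel indicE memNset ?mul0r//= in_itv/=.
exact/negP.
Qed.

Lemma scale_kernel_ge0 a b m x s : 0 < a -> 0 <= scale_kernel a b m x s.
Proof.
move=> a0; have [/andP[sa sb]|nsab] := boolP (a <= s <= b).
  rewrite scale_kernel_in ?sa// mulr_ge0 ?normal_pdf_ge0// invr_ge0.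
  by rewrite (le_trans (ltW a0)).
by rewrite scale_kernel_out.
Qed.

Lemma scale_kernel_le a b m x s : 0 < a -> scale_kernel a b m x s <= a^-1.
Proof.
move=> a0; have [/andP[sa sb]|nsab] := boolP (a <= s <= b); last first.
  by rewrite scale_kernel_out// invr_ge0 ltW.
have s0 : 0 < s by exact: lt_le_trans sa.
rewrite scale_kernel_in ?sa// -[leRHS]mulr1 ler_pM ?normal_pdf_ge0//.
- by rewrite invr_ge0 ltW.
- by rewrite lef_pV2.
have [_ p1] := andP peak_bounds.
by rewrite (le_trans (normal_pdf_ub _ _ _))// oner_neq0.
Qed.

Lemma measurable_scale_kernel2 a b m : 0 < a ->
  measurable_fun setT (fun z : R * R => scale_kernel a b m z.2 z.1).
Proof.
move=> a0; rewrite (_ : (fun _ => _) = fun z : R * R => \1_`[a, b] z.1 *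
    (z.1 `^ (-1) * normal_pdf 0 1 ((z.2 - m) * z.1 `^ (-1)))); last first.
  apply/funext => -[s x] /=; have [sab|nsab] := boolP (a <= s <= b).
    by rewrite /scale_kernel powR_inv1// (le_trans (ltW a0))//; case/andP : sab.
  by rewrite scale_kernel_out// indicE memNset ?mul0r//= in_itv/=; exact/negP.
have mpow : measurable_fun setT (fun z : R * R => z.1 `^ (-1)).
  by apply: (measurableT_comp (f := fun s : R => s `^ (-1)) (g := @fst R R));
    [exact: measurable_powR|exact: measurable_fst].
apply: measurable_funM.
  apply: (measurableT_comp (f := \1_`[a, b] : R -> R) (g := @fst R R)).
    by apply: measurable_indic; exact: measurable_itv.
  exact: measurable_fst.
apply: measurable_funM => //.
apply: (measurableT_comp (measurable_normal_pdf 0 1)).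
by apply: measurable_funM => //; exact: measurable_funB.
Qed.

Lemma measurable_scale_kernel a b m x : 0 < a ->
  measurable_fun setT (scale_kernel a b m x).
Proof.
move=> a0; apply: (measurableT_comp (measurable_scale_kernel2 b m a0)
  (g := fun s => (s, x))).
exact: measurable_fun_pair.
Qed.

Lemma Rintegral_probability_cst G (c : R) : \int[G]_s c = c.
Proof.
rewrite Rintegral_cst// [X in fine X](_ : _ = 1%E) ?mulr1//.
exact: probability_setT.
Qed.

Lemma integrable_bounded G (f : R -> R) M : measurable_fun setT f ->
  (forall s, `|f s| <= M) -> G.-integrable setT (EFin \o f).
Proof.
move=> mf fM; apply: measurable_bounded_integrable => //.
  by rewrite (le_lt_trans (probability_le1 _ _)) ?ltry.
exists M; split; first exact: num_real.
by move=> N /ltW MN s _ /=; rewrite (le_trans (fM s)).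
Qed.

Lemma integrable_scale_kernel G a b m x : 0 < a ->
  G.-integrable setT (EFin \o scale_kernel a b m x).
Proof.
move=> a0; apply: (@integrable_bounded _ _ a^-1).
  exact: measurable_scale_kernel.
by move=> s; rewrite ger0_norm ?scale_kernel_ge0 ?scale_kernel_le.
Qed.

Lemma mixture_densityE G a b m x : 0 < a -> G `[a, b]%classic = 1%E ->
  mixture_density m G x = \int[G]_s scale_kernel a b m x s.
Proof.
move=> a0 G1; congr fine.
have mab : measurable (`[a, b]%classic : set R) by exact: measurable_itv.
have mpos : measurable (`]0, +oo[%classic : set R) by exact: measurable_itv.
have mf : measurable_fun (`]0, +oo[%classic : set R)
    (fun s => (s^-1 * normal_pdf 0 1 ((x - m) / s))%:E).
  apply/measurable_EFinP.
  apply: (eq_measurable_fun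
      (fun s => s `^ (-1) * normal_pdf 0 1 ((x - m) * s `^ (-1)))).
    move=> s; rewrite inE/= in_itv/= andbT => s0.
    by rewrite powR_inv1// ltW.
  apply: measurable_funTS; apply: measurable_funM; first exact: measurable_powR.
  apply: (measurableT_comp (measurable_normal_pdf 0 1)).
  by apply: measurable_funM => //; exact: measurable_powR.
have GC0 : G (~` `[a, b]) = 0%E by rewrite probability_setC// G1 subee.
rewrite (@ge0_negligible_integral _ _ _ _ _ (~` `[a, b]))//=; first last.
- move=> s; rewrite in_itv/= andbT => s0; rewrite lee_fin.
  by rewrite mulr_ge0 ?normal_pdf_ge0// invr_ge0 ltW.
- exact: measurableC.
rewrite setDE setCK [LHS]integral_mkcond; apply: eq_integral => s _.
rewrite patchE; have [sab|nsab] := boolP (a <= s <= b).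
  rewrite mem_set ?scale_kernel_in//; split => /=; rewrite in_itv//= andbT.
  by case/andP : sab => + _; exact: lt_le_trans.
rewrite memNset ?scale_kernel_out// => -[_]/=.
by rewrite in_itv/=; exact/negP.
Qed.

Lemma mixture_density_ge0 G a b m x : 0 < a -> G `[a, b]%classic = 1%E ->
  0 <= mixture_density m G x.
Proof.
move=> a0 G1; rewrite (@mixture_densityE _ a b)//.
by apply: Rintegral_ge0 => s _; exact: scale_kernel_ge0.
Qed.

Lemma mixture_density_gt0 G a b m x : 0 < a -> a <= b ->
  G `[a, b]%classic = 1%E -> 0 < mixture_density m G x.
Proof.
move=> a0 ab G1; rewrite (@mixture_densityE _ a b)//.
pose l := b^-1 * normal_pdf 0 1 ((x - m) / a).
have l0 : 0 < l.
  rewrite mulr_gt0//; first by rewrite invr_gt0 (lt_le_trans a0).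
  by rewrite std_normal_pdfE mulr_gt0 ?expR_gt0.
have mab : measurable (`[a, b]%classic : set R) by exact: measurable_itv.
have lI : \int[G]_s (l * \1_`[a, b] s) = l.
  rewrite /Rintegral.
  under eq_integral do rewrite EFinM.
  rewrite ge0_integralZl//=; last 2 first.
  - by apply/measurable_EFinP; exact: measurable_indic.
  - by rewrite lee_fin ltW.
  rewrite integral_indic// setIT -[RHS]/(fine l%:E) -[X in _ = fine X]mule1.
  by congr (fine (_ * _)%E).
rewrite (lt_le_trans l0)// -[leLHS]lI le_Rintegral//.
- apply: (@integrable_bounded _ _ l).
    by apply: measurable_funM => //; exact: measurable_indic.
  move=> s; rewrite normrM gtr0_norm// ler_piMr//; first exact: ltW.
  by rewrite indicE normr_nat lern1 leq_b1.
- exact: integrable_scale_kernel.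
move=> s _; have [sab|nsab] := boolP (a <= s <= b); last first.
  by rewrite scale_kernel_out// indicE memNset ?mulr0//= in_itv/=; exact/negP.
rewrite scale_kernel_in// indicE mem_set ?mulr1//=.
case/andP : sab => sa sb.
have s0 : 0 < s by exact: lt_le_trans sa.
rewrite ler_pM//.
- by rewrite invr_ge0 (le_trans (ltW s0)).
- exact: normal_pdf_ge0.
- by rewrite lef_pV2// posrE (lt_le_trans s0).
rewrite 2!std_normal_pdfE ler_pM2l// ler_expR lerN2 ler_pM2r//.
rewrite !exprMn ler_wpM2l ?sqr_ge0// !exprVn lef_pV2 ?posrE ?exprn_gt0//.
by rewrite ler_sqr// nnegrE ltW.
Qed.

Lemma EFin_mixture_density G a b m x : 0 < a -> G `[a, b]%classic = 1%E ->
  (mixture_density m G x)%:E = (\int[G]_s (scale_kernel a b m x s)%:E)%E.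
Proof.
move=> a0 G1; rewrite (@mixture_densityE _ a b)// fineK//.
by apply: integrable_fin_num => //; exact: integrable_scale_kernel.
Qed.

Let kernel2 a b m : R * R -> \bar R := fun z => (scale_kernel a b m z.2 z.1)%:E.

Let measurable_kernel2 a b m : 0 < a -> measurable_fun setT (kernel2 a b m).
Proof. by move=> a0; apply/measurable_EFinP; exact: measurable_scale_kernel2. Qed.

Let kernel2_ge0 a b m z : 0 < a -> (0 <= kernel2 a b m z)%E.
Proof. by move=> a0; rewrite lee_fin scale_kernel_ge0. Qed.

Lemma measurable_mixture_density G a b m : 0 < a -> G `[a, b]%classic = 1%E ->
  measurable_fun setT (mixture_density m G).
Proof.
move=> a0 G1; apply/measurable_EFinP.
rewrite (_ : _ \o _ = fubini_G G (kernel2 a b m)); last first.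
  by apply/funext => x; rewrite /= (@EFin_mixture_density _ a b).
apply: measurable_fun_fubini_tonelli_G; first exact: measurable_kernel2.
by move=> z; exact: kernel2_ge0.
Qed.

Lemma integral_mixture_density G a b m : 0 < a -> G `[a, b]%classic = 1%E ->
  (\int[lebesgue_measure]_x (mixture_density m G x)%:E = 1)%E.
Proof.
move=> a0 G1.
under eq_integral do rewrite (@EFin_mixture_density _ a b)//.
rewrite -(@fubini_tonelli _ _ _ _ _ G lebesgue_measure (kernel2 a b m)) //=;
  last 2 first.
- exact: measurable_kernel2.
- by move=> z; exact: kernel2_ge0.
have mab : measurable (`[a, b]%classic : set R) by exact: measurable_itv.
transitivity (\int[G]_s (\1_`[a, b] s)%:E)%E; last first.
  by rewrite integral_indic// setIT; exact/esym.
apply: eq_integral => s _; have [sab|nsab] := boolP (a <= s <= b); last first.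
  rewrite indicE memNset//=; last by rewrite in_itv/=; exact/negP.
  by rewrite integral0_eq// => x _; rewrite /kernel2/= scale_kernel_out.
rewrite indicE mem_set/=; last by rewrite in_itv.
have s0 : 0 < s by case/andP : sab => sa _; exact: lt_le_trans sa.
rewrite -(integral_normal_pdf m s); apply: eq_integral => x _.
by rewrite /kernel2/= scale_kernel_in// normal_pdf_scale.
Qed.

End gaussian_kernel.

(** * Hellinger distance and symmetric mixtures *)

Section hellinger.
Context {R : realType}.
Implicit Types (p q r : R -> R) (m c t a b : R) (G : probability R R).

Local Notation mu := (@lebesgue_measure R).

Lemma measurable_sqrt d (T : measurableType d) (D : set T) (f : T -> R) :
  measurable_fun D f -> measurable_fun D (fun x => Num.sqrt (f x)).
Proof.
move=> mf; apply: (measurableT_comp (f := @Num.sqrt R)) => //.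
by apply: continuous_measurable_fun; exact: sqrt_continuous.
Qed.

Let measurable_sqr_diff p q :
  measurable_fun setT p -> measurable_fun setT q ->
  measurable_fun setT (fun x => ((Num.sqrt (p x) - Num.sqrt (q x)) ^+ 2)%:E).
Proof.
move=> mp mq; apply/measurable_EFinP; apply: measurable_funX.
by apply: measurable_funB; exact: measurable_sqrt.
Qed.

Lemma hellinger2C p q : hellinger2 p q = hellinger2 q p.
Proof. by apply: eq_integral => x _; rewrite -sqrrN opprB. Qed.

(** Squared Hellinger distance is a squared L2 distance of square roots, so the
    triangle inequality costs a factor 2. *)
Lemma hellinger2_triangle p q r : measurable_fun setT p ->
  measurable_fun setT q -> measurable_fun setT r ->
  (hellinger2 p r <= 2%:E * hellinger2 p q + 2%:E * hellinger2 q r)%E.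
Proof.
move=> mp mq mr; rewrite /hellinger2.
rewrite -!ge0_integralZl//=; [|exact: measurable_sqr_diff|
  by move=> x _; rewrite lee_fin sqr_ge0|exact: measurable_sqr_diff|
  by move=> x _; rewrite lee_fin sqr_ge0].
rewrite -ge0_integralD//=; last 4 first.
- by move=> x _; rewrite -EFinM lee_fin mulr_ge0 ?sqr_ge0.
- by apply: measurable_funeM; exact: measurable_sqr_diff.
- by move=> x _; rewrite -EFinM lee_fin mulr_ge0 ?sqr_ge0.
- by apply: measurable_funeM; exact: measurable_sqr_diff.
apply: ge0_le_integral => //=.
- by move=> x _; rewrite lee_fin sqr_ge0.
- exact: measurable_sqr_diff.
- by apply: emeasurable_funD; apply: measurable_funeM; exact: measurable_sqr_diff.
move=> x _; rewrite -!EFinM -EFinD lee_fin.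
set A := Num.sqrt _; set B := Num.sqrt _; set C := Num.sqrt _.
by have := sqr_ge0 (A - C - (C - B)); nra.
Qed.

Let reflect c (x : measurableTypeR R) : measurableTypeR R := c - x.

Let measurable_reflect c : measurable_fun setT (reflect c).
Proof. exact: measurable_funB. Qed.

Lemma lebesgue_measure_reflect c (A : set (measurableTypeR R)) : measurable A ->
  pushforward mu (reflect c) A = mu A.
Proof.
move=> mA.
apply/esym/(lebesgue_measure_unique (mu := pushforward mu (reflect c))) => //=.
move=> _ [[x y] _ <-] /=; rewrite /pushforward/=.
rewrite (_ : _ @^-1` _ = `[c - y, c - x[%classic); last first.
  by apply/seteqP; split=> z /=; rewrite /reflect !in_itv/= => /andP[? ?]; lra.
rewrite !lebesgue_measure_itv/= !lte_fin ltrD2l ltrN2.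
by case: ifP => // _; rewrite -!EFinB; congr (_%:E); lra.
Qed.

Lemma hellinger2_reflect c p q : measurable_fun setT p -> measurable_fun setT q ->
  hellinger2 (p \o (fun x => c - x)) (q \o (fun x => c - x)) = hellinger2 p q.
Proof.
move=> mp mq.
pose F (x : measurableTypeR R) := ((Num.sqrt (p x) - Num.sqrt (q x)) ^+ 2)%:E.
have mF : measurable_fun setT F by exact: measurable_sqr_diff.
transitivity (\int[pushforward mu (reflect c)]_x F x)%E.
  rewrite (ge0_integral_pushforward (measurable_reflect c))//.
  by move=> x _; rewrite lee_fin sqr_ge0.
by apply: eq_measure_integral => A mA _; exact: lebesgue_measure_reflect.
Qed.

Lemma mixture_density_reflect (G : {measure set R -> \bar R}) m c :
  mixture_density m G \o (fun x => c - x) = mixture_density (c - m) G.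
Proof.
have even (s x : R) :
    normal_pdf 0 1 ((c - x - m) / s) = normal_pdf 0 1 ((x - (c - m)) / s).
  by rewrite -[LHS]std_normal_pdfN -mulNr; congr (normal_pdf 0 1 (_ / s)); lra.
by apply/funext => x; apply: eq_Rintegral => s _ /=; rewrite even.
Qed.

(** A mixture is symmetric about its location. The reflection about [m']
    therefore fixes the mixture of [G'] and moves that of [G] from [m] to
    [2 m' - m]; it preserves Hellinger distances, and the factor 4 is the price of
    the triangle inequality between the two mirror images. *)
Lemma location_le_hellinger_modulus (G G' : {measure set R -> \bar R}) m m' t :
  (forall m, measurable_fun setT (mixture_density m G)) ->
  measurable_fun setT (mixture_density m' G') ->
  (hellinger2 (mixture_density m' G') (mixture_density m G) <= t%:E)%E ->
  (`|m' - m|%:E <= hellinger_modulus G (4 * t))%E.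
Proof.
have double : `|m' - m| <= `|m - (2 * m' - m)|.
  rewrite (_ : m - (2 * m' - m) = - (2 * (m' - m))); last lra.
  by rewrite normrN normrM normr_nat ler_peMl// ler1n.
have t4 : 4 * t = 2 * t + 2 * t by lra.
move=> mG mG' ht.
have hr : hellinger2 (mixture_density m' G') (mixture_density (2 * m' - m) G) =
    hellinger2 (mixture_density m' G') (mixture_density m G).
  rewrite -[RHS](hellinger2_reflect (2 * m') mG' (mG m)).
  rewrite 2!mixture_density_reflect (_ : 2 * m' - m' = m')//; lra.
apply: (@le_trans _ _ `|m - (2 * m' - m)|%:E); first by rewrite lee_fin double.
apply: ereal_sup_ubound; exists (m, 2 * m' - m); last by [].
apply: (le_trans (hellinger2_triangle (mG m) mG' (mG _))).
rewrite hr hellinger2C t4.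
by rewrite [leRHS]EFinD EFinM; apply: leeD; apply: lee_wpmul2l.
Qed.

Lemma affinity_le p q t : measurable_fun setT p -> measurable_fun setT q ->
  (forall x, 0 <= p x) -> (forall x, 0 <= q x) ->
  (\int[mu]_x (p x)%:E <= 1)%E -> (\int[mu]_x (q x)%:E <= 1)%E ->
  (t%:E <= hellinger2 p q)%E ->
  (\int[mu]_x (Num.sqrt (p x * q x))%:E <= (1 - t / 2)%:E)%E.
Proof.
move=> mp mq p0 q0 ip iq tpq.
have ms : measurable_fun setT (fun x => (Num.sqrt (p x * q x))%:E).
  by apply/measurable_EFinP/measurable_sqrt; exact: measurable_funM.
have s0 x : (0 <= (Num.sqrt (p x * q x))%:E)%E by rewrite lee_fin sqrtr_ge0.
have sumE : (hellinger2 p q + 2%:E * \int[mu]_x (Num.sqrt (p x * q x))%:E =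
    \int[mu]_x (p x)%:E + \int[mu]_x (q x)%:E)%E.
  rewrite -ge0_integralZl//= -!ge0_integralD//=.
  - apply: eq_integral => x _; rewrite -EFinM -!EFinD; congr (_%:E).
    rewrite sqrrB !sqr_sqrtr// sqrtrM//; lra.
  - by move=> x _; rewrite lee_fin.
  - exact/measurable_EFinP.
  - by move=> x _; rewrite lee_fin.
  - exact/measurable_EFinP.
  - by move=> x _; rewrite lee_fin sqr_ge0.
  - exact: measurable_sqr_diff.
  - exact: measurable_funeM.
have le2 : (hellinger2 p q + 2%:E * \int[mu]_x (Num.sqrt (p x * q x))%:E <= 2%:E)%E.
  by rewrite sumE (_ : 2 = 1 + 1) // EFinD leeD.
have I0 : (0 <= \int[mu]_x (Num.sqrt (p x * q x))%:E)%E by exact: integral_ge0.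
move: (\int[mu]_x _)%E I0 le2 => I I0 /(le_trans (leeD2r _ tpq)).
case: I I0 => [r| |] //= _; last first.
  by rewrite mulry gtr0_sg// mul1e.
by rewrite -EFinM -EFinD !lee_fin; lra.
Qed.

End hellinger.

(** * The empirical mixture *)

Section empirical_mixture.
Context {R : realType}.

Lemma ge0_integral_empirical n (sigma : 'I_n -> R) (f : R -> \bar R) :
  measurable_fun setT f -> (forall x, (0 <= f x)%E) ->
  (\int[empirical_measure sigma]_x f x =
   (n%:R^-1)%:E * \sum_(i < n) f (sigma i))%E.
Proof.
move=> mf f0.
pose tau (k : nat) : {measure set R -> \bar R} :=
  if insub k is Some i then \d_(sigma i) else mzero.
have n0 : 0 <= n%:R^-1 :> R by rewrite invr_ge0.
rewrite (eq_measure_integral (mscale (NngNum n0) (msum tau n))).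
  rewrite ge0_integral_mscale//= ge0_integral_measure_sum//; congr (_ * _)%E.
  apply: eq_bigr => i _; rewrite /tau valK integral_dirac//.
  by rewrite diracT mul1e.
move=> A mA _; rewrite /empirical_measure /mscale /msum /=; congr (_ * _)%E.
by apply: eq_bigr => i _; rewrite /tau valK.
Qed.

Section probability.
Variables (n : nat) (sigma : 'I_n.+1 -> R).

HB.instance Definition _ := Measure_isProbability.Build _ _ R
  (empirical_measure sigma) (empirical_measure_setT sigma (ltn0Sn n)).

Definition empirical_probability : probability R R := empirical_measure sigma.

End probability.

Lemma empirical_probability_itv n (sigma : 'I_n.+1 -> R) a b :
  (forall i, a <= sigma i <= b) ->
  empirical_probability sigma `[a, b]%classic = 1%E.
Proof.
move=> sab; rewrite -[LHS]/(empirical_measure sigma _) /empirical_measure.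
rewrite -[RHS](empirical_measure_setT sigma)//; congr (_ * _)%E.
by apply: eq_bigr => i _; rewrite !diracE !mem_set//= in_itv/= sab.
Qed.

Lemma mixture_density_empirical n (sigma : 'I_n.+1 -> R) a b m x :
  0 < a -> (forall i, a <= sigma i <= b) ->
  mixture_density m (empirical_measure sigma) x =
  n.+1%:R^-1 * \sum_(i < n.+1) normal_pdf m (sigma i) x.
Proof.
move=> a0 sab; have E1 := empirical_probability_itv sab.
apply: EFin_inj; have := EFin_mixture_density m x a0 E1.
rewrite /= => ->; rewrite ge0_integral_empirical; first last.
- by move=> s; rewrite lee_fin scale_kernel_ge0.
- by apply/measurable_EFinP; exact: measurable_scale_kernel.
rewrite sumEFin -EFinM; congr (_ * _)%:E; apply: eq_bigr => i _.
rewrite scale_kernel_in// normal_pdf_scale//.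
by have /andP[+ _] := sab i; exact: lt_le_trans.
Qed.

End empirical_mixture.

(** * Likelihood ratios of independent, non-identically distributed observations *)

Lemma sqrtr_prod (R : rcfType) (I : Type) (r : seq I) (P : pred I)
    (F : I -> R) : (forall i, 0 <= F i) ->
  Num.sqrt (\prod_(i <- r | P i) F i) = \prod_(i <- r | P i) Num.sqrt (F i).
Proof.
move=> F0; elim/big_rec2 : _ => [|i x y _ <-]; first exact: sqrtr1.
by rewrite sqrtrM.
Qed.

Section likelihood_ratio.
Local Open Scope ereal_scope.
Context d (T : measurableType d) (R : realType) (P : probability T R).
Variables (n : nat) (X : 'I_n.+1 -> {RV P >-> R}) (p : 'I_n.+1 -> R -> R).
Hypothesis indep : mutually_independent X.
Hypotheses (mp : forall i, measurable_fun setT (p i))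
  (p0 : forall i x, (0 <= p i x)%R).
Hypothesis density : forall i (B : set R), measurable B ->
  P (X i @^-1` B) = \int[lebesgue_measure]_(x in B) (p i x)%:E.

Let f x : R := (n.+1%:R^-1 * \sum_(i < n.+1) p i x)%R.

Variable g : R -> R.
Hypotheses (mg : measurable_fun setT g) (g0 : forall x, (0 <= g x)%R).
Hypothesis f0 : forall x, (0 < f x)%R.

Let mf : measurable_fun setT f.
Proof. by apply: measurable_funM => //; exact: measurable_sum. Qed.

Let mX i (h : R -> R) : measurable_fun setT h ->
  measurable_fun setT (fun w => h (X i w)).
Proof. by move=> mh; exact: measurableT_comp. Qed.

Lemma measurable_likelihood_le :
  measurable [set w | (\prod_(i < n.+1) f (X i w) <=
                       \prod_(i < n.+1) g (X i w))%R].
Proof.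
have mprod (h : R -> R) : measurable_fun setT h ->
    measurable_fun setT (fun w => \prod_(i < n.+1) h (X i w))%R.
  by move=> mh; apply: measurable_prod => i _; exact: mX.
have := measurable_fun_le (D := setT) measurableT (mprod _ mf) (mprod _ mg).
by rewrite setTI.
Qed.

(** Markov's inequality for the square root of the likelihood ratio. The
    expectation factorizes, and since the observations need not be identically
    distributed, the inequality between the geometric and the arithmetic mean
    brings in the average density. *)
Lemma likelihood_le_probability (A : R) :
  \int[lebesgue_measure]_x (Num.sqrt (g x * f x))%:E <= A%:E ->
  P [set w | (\prod_(i < n.+1) f (X i w) <= \prod_(i < n.+1) g (X i w))%R]
    <= (A ^+ n.+1)%:E.
Proof.
move=> IA; set E := [set w | _]; have mE : measurable E by exact: measurable_likelihood_le.
pose phi x := Num.sqrt (g x / f x).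
have phi0 x : (0 <= phi x)%R by exact: sqrtr_ge0.
have mphi : measurable_fun setT phi.
  apply: measurable_sqrt; apply: measurable_funM => //.
  rewrite (_ : (fun x => (f x)^-1) = (fun x => f x `^ (-1)))%R; last first.
    by apply/funext => x; rewrite powR_inv1// ltW.
  by apply: (measurableT_comp (f := fun s : R => (s `^ (-1))%R));
    [exact: measurable_powR|exact: mf].
have fphi x : (f x * phi x = Num.sqrt (g x * f x))%R.
  rewrite -{1}[f x]sqr_sqrtr ?ltW// expr2 -mulrA -sqrtrM ?ltW//.
  by rewrite mulrCA divff ?gt_eqF// mulr1 mulrC -sqrtrM// mulrC.
have mpphi i : measurable_fun setT (fun x => (p i x * phi x)%:E).
  by apply/measurable_EFinP; exact: (measurable_funM (mp i) mphi).
have pphi0 i x : 0 <= (p i x * phi x)%:E by rewrite lee_fin mulr_ge0.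
have sumI : \sum_(i < n.+1) \int[lebesgue_measure]_x (p i x * phi x)%:E <=
    (n.+1%:R * A)%:E.
  rewrite -ge0_integral_sum//=.
  rewrite EFinM (le_trans _ (lee_wpmul2l _ IA))//.
  rewrite -ge0_integralZl//=; last first.
    by apply/measurable_EFinP/measurable_sqrt; exact: (measurable_funM mg mf).
  rewrite le_eqVlt; apply/orP; left; apply/eqP.
  apply: eq_integral => x _; rewrite sumEFin -EFinM -fphi -mulr_suml mulrA.
  by rewrite /f mulrA divff ?mul1r// pnatr_eq0.
have finI i : \int[lebesgue_measure]_x (p i x * phi x)%:E < +oo.
  apply: le_lt_trans (ltry (n.+1%:R * A)); apply: le_trans sumI.
  rewrite (bigD1 i)//= leeDl// sume_ge0// => j _.
  by apply: integral_ge0 => x _; exact: pphi0.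
pose a i := fine (\int[lebesgue_measure]_x (p i x * phi x)%:E).
have aE i : \int[lebesgue_measure]_x (p i x * phi x)%:E = (a i)%:E.
  by rewrite fineK// ge0_fin_numE// integral_ge0// => x _; exact: pphi0.
have a0 i : (0 <= a i)%R.
  by rewrite -lee_fin -aE integral_ge0// => x _; exact: pphi0.
apply: (@le_trans _ _ (\int[P]_w (\prod_(i < n.+1) phi (X i w))%:E)).
  rewrite -[X in P X](setIT E) -integral_indic//; apply: ge0_le_integral => //=.
  - by apply/measurable_EFinP; exact: measurable_indic.
  - by apply/measurable_EFinP; apply: measurable_prod => i _; exact: mX.
  move=> w _; rewrite lee_fin indicE; have [|_] := boolP (w \in E); last first.
    by apply: prodr_ge0.
  rewrite inE => /= wE.
  rewrite /phi -sqrtr_prod; last by move=> i; rewrite divr_ge0// ltW.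
  rewrite -[leLHS]sqrtr1 ler_wsqrtr// prodf_div ler_pdivlMr ?mul1r//.
  exact: prodr_gt0.
rewrite (expectation_prod_independent (phi := fun=> phi) indep mp p0 density)//.
rewrite (eq_bigr (fun i => (a i)%:E)); last by move=> i _; exact: aE.
rewrite prodEFin lee_fin.
have sum_a : (\sum_(i < n.+1) a i <= n.+1%:R * A)%R.
  by rewrite -lee_fin -sumEFin; under eq_bigr do rewrite -aE.
have [+ _] := @leif_AGM R _ (mem 'I_n.+1) a (fun i _ => a0 i).
rewrite card_ord => /le_trans; apply; apply: lerXn2r.
- by rewrite nnegrE mulr_ge0 ?sumr_ge0.
- rewrite nnegrE -(@pmulr_rge0 _ n.+1%:R) ?ltr0n//.
  by apply: le_trans sum_a; exact: sumr_ge0.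
by rewrite ler_pdivrMr ?ltr0n// mulrC.
Qed.

End likelihood_ratio.

(** * Gaussian estimates *)

Section gaussian_estimates.
Context {R : realType}.
Implicit Types (a b c m x s u v : R) (G : probability R R).

Local Notation peak := (normal_peak (1 : R)).

Lemma expR1_le3 : expR 1 <= 3 :> R.
Proof.
have h : expR (6^-1) <= 6 / 5 :> R.
  (* e ^ (- 1 / 6) >= 5 / 6, and (6 / 5) ^ 6 < 3 *)
  rewrite -[leLHS]invrK -expRN -[leRHS]invrK lef_pV2 ?posrE ?expR_gt0//.
  have := expR_ge1Dx (- 6^-1 : R); lra.
rewrite (_ : 1 = 6%:R * 6^-1 :> R); last by lra.
rewrite expRM_natl; apply: (@le_trans _ _ ((6 / 5) ^+ 6)); last by lra.
by rewrite lerXn2r// nnegrE ?expR_ge0//; lra.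
Qed.

Let gauss v : R := expR (- (v ^+ 2 / 2)).

Let gauss_le1 v : gauss v <= 1.
Proof. by rewrite expR_le1 oppr_le0 divr_ge0 ?sqr_ge0. Qed.

Let norm_mul_gauss_le1 v : `|v| * gauss v <= 1.
Proof.
rewrite /gauss expRN ler_pdivrMr ?expR_gt0// mul1r.
have := expR_ge1Dx (v ^+ 2 / 2); apply: le_trans.
rewrite -(real_normK (num_real v)); have := sqr_ge0 (`|v| - 1); nra.
Qed.

(* Only the smaller of the two points carries the Gaussian weight, which makes
   the squares of large arguments harmless. *)
Let gauss_lipschitz u v : `|gauss u - gauss v| <= 2 * `|u - v|.
Proof.
have gaussE w : gauss w = gauss `|w| by rewrite /gauss real_normK ?num_real.
wlog : u v / `|u| <= `|v|.
  move=> H; have [uv|/ltW vu] := leP `|u| `|v|; first exact: H.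
  by rewrite distrC (distrC u); exact: H.
rewrite (gaussE u) (gaussE v) => uv.
have := lerB_dist v u; rewrite (distrC v u) => duv.
have u0 : 0 <= `|u| by []; have := norm_mul_gauss_le1 `|u|; rewrite normr_id.
move: `|u| `|v| `|u - v| uv duv u0 => p q d pq dpq p0 pg.
have g1 := gauss_le1 p; have g0 : 0 <= gauss p := expR_ge0 _.
have gq0 : 0 <= gauss q := expR_ge0 _.
have step : gauss p - gauss q <= gauss p * ((q ^+ 2 - p ^+ 2) / 2).
  rewrite (_ : gauss q = gauss p * expR (- ((q ^+ 2 - p ^+ 2) / 2))); last first.
    by rewrite /gauss -expRD; congr expR; lra.
  have := expR_ge1Dx (- ((q ^+ 2 - p ^+ 2) / 2)) => H.
  rewrite -{1}[gauss p]mulr1 -mulrBr ler_wpM2l//; lra.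
have pos : 0 <= gauss p - gauss q.
  by rewrite subr_ge0 ler_expR lerN2 ler_pM2r// ler_sqr ?nnegrE ?(le_trans p0).
rewrite ger0_norm//.
have [d1|d1] := leP 1 (q - p); first by lra.
apply: (le_trans step).
apply: (@le_trans _ _ ((gauss p * p) * (q - p) + gauss p * ((q - p) * (q - p)) / 2)).
  by rewrite le_eqVlt; apply/orP; left; apply/eqP; field.
have : (gauss p * p) * (q - p) <= 1 * (q - p) by apply: ler_wpM2r; [lra|rewrite mulrC].
have : gauss p * ((q - p) * (q - p)) <= 1 * (1 * (q - p)).
  by apply: ler_pM => //; [apply: mulr_ge0; lra|apply: ler_wpM2r; lra].
lra.
Qed.

Lemma scale_kernel_tail a b m mu x s : 0 < a ->
  scale_kernel a b m x s * `|m - mu| <= 1 + `|x - mu| / a.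
Proof.
move=> a0; have p0 : 0 <= `|x - mu| / a by rewrite divr_ge0// ltW.
have [sab|nsab] := boolP (a <= s <= b); last first.
  by rewrite scale_kernel_out// mul0r; lra.
have k1 : scale_kernel a b m x s * `|x - m| <= 1.
  rewrite scale_kernel_in//; case/andP : sab => sa sb.
  have s0 : 0 < s by exact: lt_le_trans sa.
  rewrite std_normal_pdfE; have /andP[c0 c1] := @peak_bounds R.
  have := norm_mul_gauss_le1 ((x - m) / s).
  rewrite normrM normfV (gtr0_norm s0) => h.
  rewrite -/(gauss _) (_ : s^-1 * (_ * _) * _ =
    peak * (`|x - m| / s * gauss ((x - m) / s))); last by ring.
  have g0 : 0 <= `|x - m| / s * gauss ((x - m) / s).
    by rewrite mulr_ge0 ?expR_ge0// divr_ge0// ltW.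
  by rewrite -[leRHS]mul1r ler_pM//; lra.
have k2 : scale_kernel a b m x s * `|x - mu| <= `|x - mu| / a.
  by rewrite mulrC ler_wpM2l// scale_kernel_le.
have k0 := scale_kernel_ge0 b m x s a0.
have : `|m - mu| <= `|x - m| + `|x - mu|.
  by rewrite (distrC x m); apply: le_trans (ler_normD _ _); rewrite addrA subrK.
move/(ler_wpM2l k0) => /le_trans; apply; rewrite mulrDr; lra.
Qed.

Lemma scale_kernel_shift a b m m' x s : 0 < a ->
  `|scale_kernel a b m x s - scale_kernel a b m' x s| <=
  2 * `|m - m'| / a ^+ 2.
Proof.
move=> a0; have [sab|nsab] := boolP (a <= s <= b); last first.
  rewrite !scale_kernel_out// subrr normr0; apply: divr_ge0; last exact: sqr_ge0.
  by rewrite mulr_ge0.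
rewrite !scale_kernel_in//; case/andP : sab => sa sb.
have s0 : 0 < s by exact: lt_le_trans sa.
rewrite 2!std_normal_pdfE -mulrBr -mulrBr normrM normrM.
have /andP[c0 c1] := @peak_bounds R.
rewrite (@gtr0_norm _ s^-1) ?invr_gt0// (@gtr0_norm _ peak); last by lra.
have := gauss_lipschitz ((x - m) / s) ((x - m') / s).
rewrite -mulrBl (_ : x - m - (x - m') = - (m - m')); last by lra.
rewrite mulNr normrN normrM normfV (gtr0_norm s0) -/(gauss _) -/(gauss _) => h.
have sa' : s^-1 <= a^-1 by rewrite lef_pV2.
have ia0 : 0 < a^-1 by rewrite invr_gt0.
have is0 : 0 < s^-1 by rewrite invr_gt0.
have h' : peak * `|gauss ((x - m) / s) - gauss ((x - m') / s)| <=
    2 * (`|m - m'| * a^-1).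
  rewrite -[leRHS]mul1r ler_pM//; first by lra.
  by apply: (le_trans h); rewrite ler_wpM2l// ler_wpM2l.
apply: (@le_trans _ _ (a^-1 * (2 * (`|m - m'| * a^-1)))).
  by rewrite ler_pM// ?(ltW is0)// mulr_ge0//; lra.
by rewrite le_eqVlt; apply/orP; left; apply/eqP; field; exact: lt0r_neq0.
Qed.

Let sqrtr_le_sqr x u : 0 <= u -> x <= u ^+ 2 -> Num.sqrt x <= u.
Proof. by move=> u0 /ler_wsqrtr; rewrite sqrtr_sqr ger0_norm. Qed.

(** The growing factor is absorbed by half of the Gaussian exponent, because
    [1 + `|v| <= expR (1 + v ^+ 2 / 4)]; the square root then doubles the standard
    deviation. *)
Lemma sqrt_normal_pdf_le c b m s x : 0 <= c -> 0 < s -> s <= b ->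
  Num.sqrt (c * (1 + `|x - m| / b) * normal_pdf m s x) <=
  6 * Num.sqrt (c * b) * normal_pdf m (2 * s) x.
Proof.
move=> c0 s0 sb; have b0 : 0 < b by exact: lt_le_trans sb.
have rhs0 : 0 <= 6 * Num.sqrt (c * b) * normal_pdf m (2 * s) x.
  by rewrite mulr_ge0 ?normal_pdf_ge0// mulr_ge0 ?sqrtr_ge0.
apply: sqrtr_le_sqr => //.
have s20 : 0 < 2 * s by rewrite mulr_gt0.
rewrite -(normal_pdf_scale m x s0) -(normal_pdf_scale m x s20).
rewrite 2!std_normal_pdfE.
have /andP[c1 c2] := @peak_bounds R; set k := peak in c1 c2 *.
set v := (x - m) / s.
rewrite (_ : (x - m) / (2 * s) = v / 2); last first.
  by rewrite /v; field; exact: lt0r_neq0.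
have xv : `|x - m| / b <= `|v|.
  by rewrite /v normrM normfV (gtr0_norm s0) ler_wpM2l// lef_pV2.
have ev : (1 + `|x - m| / b) * expR (- (v ^+ 2 / 2)) <=
    3 * expR (- (v ^+ 2 / 4)).
  have le1 : 1 + `|x - m| / b <= expR (1 + v ^+ 2 / 4).
    have := expR_ge1Dx `|v|; have : expR `|v| <= expR (1 + v ^+ 2 / 4).
      rewrite ler_expR -(real_normK (num_real v)).
      by have := sqr_ge0 (`|v| / 2 - 1); nra.
    lra.
  apply: (@le_trans _ _ (expR (1 + v ^+ 2 / 4) * expR (- (v ^+ 2 / 2)))).
    by rewrite ler_wpM2r ?expR_ge0.
  rewrite -expRD (_ : _ + _ = 1 + - (v ^+ 2 / 4)); last by lra.
  by rewrite expRD ler_wpM2r ?expR_ge0 ?expR1_le3.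
have sqE : expR (- ((v / 2) ^+ 2 / 2)) ^+ 2 = expR (- (v ^+ 2 / 4)).
  by rewrite -expRM_natl; congr expR; field.
clearbody v; rewrite exprMn [(6 * _) ^+ 2]exprMn sqr_sqrtr; last by rewrite mulr_ge0// ltW.
rewrite [((2 * s)^-1 * _) ^+ 2]exprMn [(k * _) ^+ 2]exprMn sqE.
set E1 := expR (- (v ^+ 2 / 2)) in ev *; set E2 := expR (- (v ^+ 2 / 4)) in ev *.
have E20 : 0 <= E2 := expR_ge0 _.
apply: (@le_trans _ _ (c * (s^-1 * k) * (3 * E2))).
  rewrite (_ : _ * _ = c * (s^-1 * k) * ((1 + `|x - m| / b) * E1)); last by ring.
  rewrite ler_wpM2l// mulr_ge0// mulr_ge0 ?invr_ge0 ?(ltW s0)//; lra.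
rewrite (_ : _ * _ = (c * k * E2) * (3 * s^-1)); last by ring.
rewrite (_ : 6 ^+ 2 * _ * _ = (c * k * E2) * (9 * k * b * s^-1 * s^-1)); last first.
  by field; exact: lt0r_neq0.
have ck : 0 <= c * k * E2 by rewrite mulr_ge0// mulr_ge0//; lra.
rewrite ler_wpM2l// ler_wpM2r ?invr_ge0 ?(ltW s0)//.
by rewrite ler_pdivlMr//; nra.
Qed.

Lemma sqrtrD_le u v : 0 <= u -> 0 <= v ->
  Num.sqrt (u + v) <= Num.sqrt u + Num.sqrt v.
Proof.
move=> u0 v0; have a0 := sqrtr_ge0 u; have b0 := sqrtr_ge0 v.
apply: sqrtr_le_sqr; first exact: addr_ge0.
rewrite sqrrD !sqr_sqrtr//; have := mulr_ge0 a0 b0; lra.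
Qed.

Lemma sqrtr_sum_le (I : Type) (r : seq I) (P : pred I) (F : I -> R) :
  (forall i, 0 <= F i) ->
  Num.sqrt (\sum_(i <- r | P i) F i) <= \sum_(i <- r | P i) Num.sqrt (F i).
Proof.
move=> F0; elim: r => [|i r IH]; first by rewrite !big_nil sqrtr0.
rewrite !big_cons; case: ifP => // _.
apply: (le_trans (sqrtrD_le _ _)) => //; first exact: sumr_ge0.
by rewrite lerD2l.
Qed.

(** The square root of an average of Gaussians is at most a sum of wider
    Gaussians, each of integral 1. *)
Lemma integral_sqrt_envelope_le n (sigma : 'I_n.+1 -> R) b m c : 0 <= c ->
  (forall i, 0 < sigma i <= b) ->
  (\int[lebesgue_measure]_x (Num.sqrt (c * (1 + `|x - m| / b) *
     (n.+1%:R^-1 * \sum_(i < n.+1) normal_pdf m (sigma i) x)))%:E <=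
   (n.+1%:R * (6 * Num.sqrt (c * b)))%:E)%E.
Proof.
move=> c0 sb.
have s0 i : 0 < sigma i by have /andP[] := sb i.
have b0 : 0 < b by have /andP[s1 s2] := sb ord0; exact: lt_le_trans s2.
have k0 : 0 <= 6 * Num.sqrt (c * b) by rewrite mulr_ge0 ?sqrtr_ge0.
have menv : measurable_fun setT (fun x => c * (1 + `|x - m| / b)).
  apply: measurable_funM => //; apply: measurable_funD => //.
  apply: measurable_funM => //; apply: measurableT_comp => //.
  exact: measurable_funB.
have mbound i : measurable_fun setT
    (fun x => (6 * Num.sqrt (c * b) * normal_pdf m (2 * sigma i) x)%:E).
  apply/measurable_EFinP; apply: measurable_funM => //.
  exact: measurable_normal_pdf.
apply: (@le_trans _ _ (\int[lebesgue_measure]_x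
    \sum_(i < n.+1) (6 * Num.sqrt (c * b) * normal_pdf m (2 * sigma i) x)%:E)%E).
  apply: ge0_le_integral => //=.
  - apply/measurable_EFinP/measurable_sqrt/measurable_funM => //.
    apply: measurable_funM => //; apply: measurable_sum => i.
    exact: measurable_normal_pdf.
  - exact: emeasurable_sum.
  move=> x _; rewrite sumEFin lee_fin.
  set e := c * _; have e0 : 0 <= e.
    by rewrite mulr_ge0// addr_ge0// divr_ge0// ltW.
  apply: (@le_trans _ _ (Num.sqrt (\sum_(i < n.+1) e * normal_pdf m (sigma i) x))).
    apply: ler_wsqrtr; rewrite mulrCA -mulr_sumr ler_piMl//.
      by rewrite mulr_ge0// sumr_ge0// => i _; exact: normal_pdf_ge0.
    by rewrite invf_le1 ?ltr0n// ler1n.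
  apply: (le_trans (sqrtr_sum_le _ _ _)).
    by move=> i; rewrite mulr_ge0// normal_pdf_ge0.
  by apply: ler_sum => i _; apply: sqrt_normal_pdf_le => //; have /andP[] := sb i.
rewrite ge0_integral_sum//=; last first.
  by move=> i x _; rewrite lee_fin mulr_ge0// normal_pdf_ge0.
rewrite (eq_bigr (fun=> (6 * Num.sqrt (c * b))%:E)).
  by rewrite sumEFin sumr_const card_ord lee_fin [leRHS]mulr_natl.
move=> i _; under eq_integral do rewrite EFinM.
rewrite ge0_integralZl//= ?integral_normal_pdf ?mule1//.
- by apply/measurable_EFinP; exact: measurable_normal_pdf.
- by move=> x _; rewrite lee_fin normal_pdf_ge0.
Qed.

End gaussian_estimates.

(** * Polynomial approximation of the exponential *)

Section exponential_truncation.
Context {R : realType}.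
Implicit Types (w x z u : R).

Let exp_partial_sum x N : \sum_(0 <= k < N) x ^+ k / k`!%:R = series (exp_coeff x) N.
Proof. by []. Qed.

Let exp_partial_sum_le x N : 0 <= x -> \sum_(0 <= k < N) x ^+ k / k`!%:R <= expR x.
Proof.
move=> x0; rewrite exp_partial_sum; apply: nondecreasing_cvgn_le.
  by apply: nondecreasing_series => k _; rewrite /exp_coeff/= divr_ge0 ?exprn_ge0.
exact: is_cvg_series_exp_coeff.
Qed.

(** A Taylor remainder without factorials: from index [K] on, the [k]-th term is
    at most [e ^ (k - K)] times itself, that is [e ^- K] times a term of the
    series of [expR (e * w)]. *)
Lemma exp_taylor_remainder K w : 0 <= w ->
  `|expR (- w) - \sum_(0 <= k < K) (- w) ^+ k / k`!%:R| <= expR (3 * w - K%:R).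
Proof.
move=> w0; set C := expR (3 * w - K%:R).
have tail N : (K <= N)%N ->
    `|\sum_(0 <= k < N) (- w) ^+ k / k`!%:R - \sum_(0 <= k < K) (- w) ^+ k / k`!%:R|
    <= C.
  move=> KN; rewrite (big_cat_nat (leq0n K) KN)//= addrAC subrr add0r.
  apply: (le_trans (ler_norm_sum _ _ _)).
  have le1 : \sum_(K <= k < N) `|(- w) ^+ k / k`!%:R| <=
      \sum_(K <= k < N) expR (- K%:R) * ((3 * w) ^+ k / k`!%:R).
    rewrite big_nat_cond [leRHS]big_nat_cond; apply: ler_sum => k.
    rewrite andbT => /andP[Kk _].
    rewrite normrM normrX normrN (ger0_norm w0) ger0_norm; last by rewrite invr_ge0.
    rewrite mulrA ler_wpM2r ?invr_ge0// exprMn mulrA ler_peMl ?exprn_ge0//.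
    apply: (@le_trans _ _ (expR (- K%:R) * expR 1 ^+ k)); last first.
      by rewrite ler_wpM2l ?expR_ge0// lerXn2r ?nnegrE ?expR_ge0 ?expR1_le3.
    rewrite -expRM_natl mulr1 -expRD -[leLHS]expR0 ler_expR addrC subr_ge0.
    by rewrite ler_nat.
  apply: (le_trans le1); rewrite -mulr_sumr /C (addrC (3 * w)) expRD ler_wpM2l ?expR_ge0//.
  apply: le_trans (@exp_partial_sum_le (3 * w) N _); last by rewrite mulr_ge0.
  rewrite [leRHS](big_cat_nat (leq0n K) KN)//= lerDr sumr_ge0// => k _.
  by rewrite divr_ge0// exprn_ge0// mulr_ge0.
have cv : cvgn (series (exp_coeff (- w))) by exact: is_cvg_series_exp_coeff.
rewrite ler_norml; apply/andP; split.
  rewrite lerBrDr addrC; apply: limr_ge => //.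
  exists K => // N /= KN; have := tail N KN.
  rewrite ler_norml => /andP[+ _]; rewrite exp_partial_sum; lra.
rewrite lerBlDr; apply: limr_le => //.
exists K => // N /= KN; have := tail N KN.
rewrite ler_norml => /andP[_]; rewrite exp_partial_sum; lra.
Qed.

Definition truncated_coef (Z : R) (k : nat) z :=
  if z <= Z then (- z) ^+ k / k`!%:R else 0.

Lemma truncated_coef_le Z k z : 0 <= z -> `|truncated_coef Z k z| <= expR Z.
Proof.
move=> z0; rewrite /truncated_coef; case: ifPn => [zZ|_]; last first.
  by rewrite normr0 expR_ge0.
rewrite normrM normrX normrN (ger0_norm z0) ger0_norm; last by rewrite invr_ge0.
apply: (@le_trans _ _ (expR z)); last by rewrite ler_expR.
apply: le_trans (@exp_partial_sum_le z k.+1 z0).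
rewrite big_nat_recr//= lerDr sumr_ge0// => i _.
by rewrite divr_ge0// exprn_ge0.
Qed.

(** Beyond the cut-off the exponential is itself negligible, because [u] is
    bounded away from 0, and before it a Taylor polynomial in [z * u] whose
    degree is linear in [p] is accurate enough. *)
Lemma exp_truncation (p : nat) u z : 9^-1 <= u <= 1 -> 0 <= z ->
  `|expR (- (z * u)) -
    \sum_(k < 84 * p) truncated_coef (27 * p)%:R k z * u ^+ k| <=
  expR (- (3 * p)%:R).
Proof.
move=> /andP[u9 u1] z0; have [zZ|zZ] := leP z (27 * p)%:R.
  have w0 : 0 <= z * u by apply: mulr_ge0 => //; lra.
  (* 3 * 27 + 3 = 84 *)
  have := exp_taylor_remainder (84 * p) w0.
  rewrite big_mkord (eq_bigr (fun k : 'I_(84 * p) =>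
    truncated_coef (27 * p)%:R k z * u ^+ k)).
    move=> /le_trans; apply; rewrite ler_expR.
    have : z * u <= (27 * p)%:R by rewrite (le_trans _ zZ)// ler_piMr.
    rewrite !natrM; lra.
  by move=> k _; rewrite /truncated_coef zZ -mulNr exprMn mulrAC.
rewrite big1 ?subr0; last first.
  by move=> k _; rewrite /truncated_coef leNgt zZ mul0r.
rewrite ger0_norm ?expR_ge0// ler_expR lerN2.
have : z * 9^-1 <= z * u by rewrite ler_wpM2l.
move: zZ; rewrite !natrM; lra.
Qed.

End exponential_truncation.

(** * Generalized moments of the mixing distribution *)

Section block_moments.
Context {R : realType}.
Implicit Types (a b m x s : R) (p j k : nat) (G : probability R R).

Local Notation peak := (normal_peak (1 : R)).

(** This makes it possible to encode a probability by its integrals against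
    finitely many functions. The bound is uniform in [f], so the same integrals
    serve for all locations and all points [x] at once. *)
Lemma Rintegral_near_combination (I : finType) G G' (f : R -> R)
    (beta : I -> R -> R) (alpha : I -> R) (B e eta A : R) :
  measurable_fun setT f -> (forall s, `|f s| <= B) ->
  (forall i, measurable_fun setT (beta i)) ->
  (forall i s, 0 <= beta i s <= 1) ->
  (forall s, `|f s - \sum_i alpha i * beta i s| <= e) ->
  (forall i, `|alpha i| <= A) ->
  (forall i, `|\int[G]_s beta i s - \int[G']_s beta i s| <= eta) ->
  `|\int[G]_s f s - \int[G']_s f s| <= e + e + #|I|%:R * (A * eta).
Proof.
move=> mf fB mbeta beta01 fe alphaA Geta.
have ibeta H i : (H : probability R R).-integrable setT (EFin \o beta i).
  apply: (@integrable_bounded _ _ _ 1) => // s.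
  by have /andP[b0 b1] := beta01 i s; rewrite ger0_norm.
have iab H i : (H : probability R R).-integrable setT
    (EFin \o (fun s => alpha i * beta i s)).
  apply: (@integrable_bounded _ _ _ `|alpha i|) => [|s].
    exact: measurable_funM.
  have /andP[b0 b1] := beta01 i s.
  by rewrite normrM (ger0_norm b0) ler_piMr.
have mcomb : measurable_fun setT (fun s => \sum_i alpha i * beta i s).
  by apply: measurable_sum => i; exact: measurable_funM.
have combB s : `|\sum_i alpha i * beta i s| <= B + e.
  rewrite (_ : \sum_i _ = f s - (f s - \sum_i alpha i * beta i s)); last first.
    by rewrite opprB addrC subrK.
  by rewrite (le_trans (ler_normB _ _))// lerD.
have ilin H : \int[H : probability R R]_s (\sum_i alpha i * beta i s) =
    \sum_i alpha i * \int[H]_s beta i s.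
  rewrite {1}/Rintegral; under eq_integral do rewrite -sumEFin.
  rewrite integral_sum//; last by move=> i; exact: iab.
  rewrite (eq_bigr (fun i => (alpha i * \int[H]_s beta i s)%:E)).
    by rewrite sumEFin.
  move=> i _; rewrite -RintegralZl//; last exact: ibeta.
  by rewrite fineK//; apply: integrable_fin_num => //; exact: iab.
have close H : `|\int[H : probability R R]_s f s -
    \sum_i alpha i * \int[H]_s beta i s| <= e.
  have mdiff : measurable_fun setT (fun s => f s - \sum_i alpha i * beta i s).
    exact: measurable_funB.
  have idiff : H.-integrable setT
      (EFin \o (fun s => f s - \sum_i alpha i * beta i s)).
    exact: (integrable_bounded H mdiff fe).
  rewrite -ilin -RintegralB//; last 2 first.
  - exact: (integrable_bounded H mf fB).
  - exact: (integrable_bounded H mcomb combB).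
  apply: (le_trans (le_normr_Rintegral measurableT idiff)).
  rewrite -[leRHS](Rintegral_probability_cst H) le_Rintegral//.
  - apply: (integrable_bounded (M := e) H); first exact: measurableT_comp.
    by move=> s; rewrite normr_id.
  - by apply: (integrable_bounded (M := `|e|) H).
have sums : `|\sum_i alpha i * \int[G]_s beta i s -
              \sum_i alpha i * \int[G']_s beta i s| <= #|I|%:R * (A * eta).
  rewrite -sumrB; apply: (le_trans (ler_norm_sum _ _ _)).
  rewrite mulr_natl -sumr_const; apply: ler_sum => i _.
  by rewrite -mulrBr normrM ler_pM.
have cG := close G; have cG' := close G'.
move: cG cG' sums; rewrite !ler_norml => /andP[? ?] /andP[? ?] /andP[? ?].
by apply/andP; split; lra.
Qed.

(** The cut-off serves the same purpose as in [scale_kernel]. *)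
Definition inverse_on a b s : R := \1_`[a, b] s * s^-1.

Lemma measurable_inverse_on a b : 0 < a -> measurable_fun setT (inverse_on a b).
Proof.
move=> a0; rewrite (_ : inverse_on a b = fun s => \1_`[a, b] s * s `^ (-1)).
  apply: measurable_funM; last exact: measurable_powR.
  by apply: measurable_indic; exact: measurable_itv.
apply/funext => s; rewrite /inverse_on indicE.
have [|] := boolP (s \in _); last by rewrite !mul0r.
rewrite inE/= in_itv/= => /andP[sa _].
by rewrite powR_inv1// (le_trans (ltW a0)).
Qed.

(** The blocks are regular on the logarithmic scale, so that their number is
    logarithmic in [b / a]. On the [j]-th of them the value is
    [a / s * u ^+ k] with [u] as in [exp_truncation]; the normalization by [a] and
    [a * expR j%:R] keeps it between 0 and 1. *)
Definition block_moment a b j k s : R :=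
  \1_`[a * expR j%:R, a * expR j.+1%:R[ s * (a * inverse_on a b s) *
  ((a * expR j%:R * inverse_on a b s) ^+ 2) ^+ k.

Lemma measurable_block_moment a b j k : 0 < a ->
  measurable_fun setT (block_moment a b j k).
Proof.
move=> a0; have mi := measurable_inverse_on b a0.
apply: measurable_funM; last first.
  by apply: measurable_funX; apply: measurable_funX; exact: measurable_funM.
apply: measurable_funM; last exact: measurable_funM.
by apply: measurable_indic; exact: measurable_itv.
Qed.

Lemma block_moment_out a b j k s : ~~ (a <= s <= b) -> block_moment a b j k s = 0.
Proof.
move=> nsab; rewrite /block_moment /inverse_on [\1_`[a, b] s]indicE memNset.
  by rewrite mul0r mulr0 mulr0 mul0r.
by rewrite /= in_itv/=; exact/negP.
Qed.

Lemma block_moment_other a b j k s :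
  ~~ (a * expR j%:R <= s < a * expR j.+1%:R) -> block_moment a b j k s = 0.
Proof.
move=> nsab; rewrite /block_moment [X in X * _ * _]indicE memNset ?mul0r//.
by rewrite /= in_itv/=; exact/negP.
Qed.

Lemma block_moment_in a b j k s :
  a <= s <= b -> a * expR j%:R <= s < a * expR j.+1%:R ->
  block_moment a b j k s = a / s * ((a * expR j%:R / s) ^+ 2) ^+ k.
Proof.
move=> sab sj; rewrite /block_moment /inverse_on !indicE !mem_set/= ?in_itv//=.
by rewrite !mul1r.
Qed.

Lemma block_moment_01 a b j k s : 0 < a -> 0 <= block_moment a b j k s <= 1.
Proof.
move=> a0; have [sab|nsab] := boolP (a <= s <= b); last first.
  by rewrite block_moment_out// lexx ler01.
have [sj|nsj] := boolP (a * expR j%:R <= s < a * expR j.+1%:R); last first.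
  by rewrite block_moment_other// lexx ler01.
rewrite block_moment_in//; have /andP[sa _] := sab; have /andP[js _] := sj.
have s0 : 0 < s by exact: lt_le_trans sa.
have as0 : 0 <= a / s by rewrite divr_ge0// ltW.
have aj0 : 0 <= a * expR j%:R / s.
  by rewrite divr_ge0 ?(ltW s0)// mulr_ge0 ?expR_ge0// ltW.
have as1 : a / s <= 1 by rewrite ler_pdivrMr// mul1r.
have aj1 : a * expR j%:R / s <= 1 by rewrite ler_pdivrMr// mul1r.
by rewrite mulr_ge0 ?exprn_ge0//= mulr_ile1 ?exprn_ge0// !exprn_ile1 ?exprn_ge0.
Qed.

Definition block_coef a p m x (jk : 'I_p * 'I_(84 * p)) : R :=
  peak / a *
  truncated_coef (27 * p)%:R jk.2 ((x - m) ^+ 2 / (2 * (a * expR jk.1%:R) ^+ 2)).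

Lemma block_coef_le a p m x jk : 0 < a ->
  `|@block_coef a p m x jk| <= a^-1 * expR (27 * p)%:R.
Proof.
move=> a0; have /andP[c0 c1] := @peak_bounds R.
rewrite normrM ler_pM//; last first.
  apply: truncated_coef_le; apply: divr_ge0; first exact: sqr_ge0.
  by apply: mulr_ge0 => //; exact: sqr_ge0.
have ia0 : 0 <= a^-1 by rewrite invr_ge0 ltW.
by rewrite ger0_norm ?ler_piMl// mulr_ge0//; lra.
Qed.

(** On a block the scale parameter varies by a factor [expR 1] only, which is
    what [exp_truncation] asks for. *)
Lemma scale_kernel_near_combination a b p m x s : 0 < a -> ln (b / a) < p%:R ->
  `|scale_kernel a b m x s -
    \sum_(jk : 'I_p * 'I_(84 * p))
      block_coef a m x jk * block_moment a b jk.1 jk.2 s| <=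
  a^-1 * expR (- (3 * p)%:R).
Proof.
move=> a0 bap; have [sab|nsab] := boolP (a <= s <= b); last first.
  rewrite scale_kernel_out// big1 ?subrr ?normr0.
    by rewrite mulr_ge0 ?expR_ge0// invr_ge0 ltW.
  by move=> jk _; rewrite block_moment_out// mulr0.
have /andP[sa sb] := sab; have s0 : 0 < s by exact: lt_le_trans sa.
have sa1 : 1 <= s / a by rewrite ler_pdivlMr// mul1r.
have b0 : 0 < b by exact: lt_le_trans sb.
have [y [y0 yp sE]] : exists y, [/\ 0 <= y, y < p%:R & s = a * expR y].
  exists (ln (s / a)); split; first exact: ln_ge0.
    rewrite (le_lt_trans _ bap)// ler_ln ?posrE ?divr_gt0//.
    by rewrite ler_pM2r// invr_gt0.
  by rewrite lnK ?posrE ?divr_gt0// mulrCA divff ?mulr1// gt_eqF.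
pose j := Num.truncn y.
have /andP[jl ju] : j%:R <= y < j.+1%:R by exact: truncn_itv.
have jp : (j < p)%N by rewrite truncn_lt_nat.
have sj : a * expR j%:R <= s < a * expR j.+1%:R.
  by rewrite sE !ler_pM2l// !ltr_pM2l// ler_expR ltr_expR jl ju.
have aj0 : 0 < a * expR j%:R by rewrite mulr_gt0 ?expR_gt0.
pose z := (x - m) ^+ 2 / (2 * (a * expR j%:R) ^+ 2).
pose u := (a * expR j%:R / s) ^+ 2.
have z0 : 0 <= z.
  by apply: divr_ge0; [exact: sqr_ge0|apply: mulr_ge0 => //; exact: sqr_ge0].
have zu : z * u = ((x - m) / s) ^+ 2 / 2.
  by rewrite /z /u; field; rewrite !lt0r_neq0 ?expR_gt0.
have u01 : 9^-1 <= u <= 1.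
  have /andP[js sj1] := sj; rewrite /u.
  have ys1 : a * expR j%:R / s <= 1 by rewrite ler_pdivrMr// mul1r.
  have ys3 : 3^-1 <= a * expR j%:R / s.
    rewrite ler_pdivlMr// mulrC ler_pdivrMr// (le_trans (ltW sj1))//.
    by rewrite -natr1 expRD mulrA ler_wpM2l ?(ltW aj0)// expR1_le3.
  by move: (_ / s) ys1 ys3 => q q1 q3; apply/andP; split; nra.
rewrite -(pair_bigA _ (fun (j' : 'I_p) (k : 'I_(84 * p)) =>
  block_coef a m x (j', k) * block_moment a b j' k s))/=.
rewrite (bigD1 (Ordinal jp))//= [X in _ - (_ + X)]big1 ?addr0; last first.
  move=> j' jj'; rewrite big1// => k _; rewrite block_moment_other ?mulr0//.
  apply: contra jj' => /andP[l r]; apply/eqP/val_inj => /=.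
  apply/esym/truncn_def; move: l r; rewrite sE ler_pM2l// ltr_pM2l//.
  by rewrite ler_expR ltr_expR => -> ->.
have -> : \sum_(k < 84 * p)
      block_coef a m x (Ordinal jp, k) * block_moment a b j k s =
    peak / s * \sum_(k < 84 * p) truncated_coef (27 * p)%:R k z * u ^+ k.
  rewrite mulr_sumr; apply: eq_bigr => k _.
  rewrite block_moment_in// /block_coef/= -/z -/u.
  by field; rewrite !lt0r_neq0.
rewrite scale_kernel_in// std_normal_pdfE -zu.
rewrite (_ : s^-1 * (peak * _) = peak / s * expR (- (z * u))); last by ring.
rewrite -mulrBr normrM; have /andP[c0 c1] := @peak_bounds R.
rewrite ler_pM//; last exact: exp_truncation.
rewrite ger0_norm; last by rewrite divr_ge0 ?(ltW s0)//; lra.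
by rewrite -[leRHS]mul1r ler_pM ?invr_ge0 ?lef_pV2 ?(ltW s0)//; lra.
Qed.

End block_moments.

(** * Covering the mixtures by finitely many codes *)

Section codes.
Context {R : realType}.
Implicit Types (a b m x s : R) (p : nat) (G : probability R R).

Let rounding_lt1 (u v : R) : 0 <= u -> 0 <= v ->
  Num.truncn u = Num.truncn v -> `|u - v| < 1.
Proof.
move=> u0 v0 uv; have /andP[ul uu] := truncn_itv u0.
have /andP[vl vu] := truncn_itv v0; rewrite uv -natr1 in ul uu.
rewrite -natr1 in vu; rewrite ltr_norml; apply/andP; split; lra.
Qed.

Let le_expR1 : 2 <= expR 1 :> R.
Proof. by have := expR_ge1Dx (1 : R); lra. Qed.

Let three_le : 3 <= expR 2 :> R.
Proof.
rewrite (_ : 2 = 2%:R * 1 :> R); last by rewrite mulr1.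
by rewrite expRM_natl expr2; have := le_expR1; nra.
Qed.

(** The block moments rounded down to multiples of [1 / D]. There are of the
    order of [p ^ 2] moments with [D + 1] values each and [ln D] is of the order
    of [p], whence the cube. *)
Lemma moment_code a b p : 0 < a -> (0 < p)%N -> ln (b / a) < p%:R ->
  exists (J : finType) (code : probability R R -> J),
    (forall G G', G `[a, b]%classic = 1%E -> G' `[a, b]%classic = 1%E ->
       code G = code G' -> forall m x,
       `|mixture_density m G x - mixture_density m G' x| <=
       3 * (a^-1 * expR (- (3 * p)%:R))) /\
    #|J|%:R <= expR (6216 * p%:R ^+ 3) :> R.
Proof.
move=> a0 p0 bap.
pose N := (p * (84 * p))%N; pose D := (N * 3 ^ (30 * p))%N.
have N0 : (0 < N)%N by rewrite !muln_gt0 p0.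
have D0 : (0 < D)%N by rewrite muln_gt0 N0 expn_gt0.
have DR0 : 0 < D%:R :> R by rewrite ltr0n.
pose I := ('I_p * 'I_(84 * p))%type.
have cardI : #|{: I}| = N by rewrite card_prod !card_ord.
pose M G (jk : I) : R := \int[G]_s block_moment a b jk.1 jk.2 s.
have ibm G (jk : I) : G.-integrable setT (EFin \o block_moment a b jk.1 jk.2).
  apply: (@integrable_bounded _ _ _ 1); first exact: measurable_block_moment.
  by move=> s; have /andP[b0 b1] := block_moment_01 b jk.1 jk.2 s a0; rewrite ger0_norm.
have M01 G jk : 0 <= M G jk <= 1.
  apply/andP; split.
    apply: Rintegral_ge0 => s _.
    by have /andP[] := block_moment_01 b jk.1 jk.2 s a0.
  rewrite -[leRHS](Rintegral_probability_cst G); apply: le_Rintegral => //.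
  - exact: ibm.
  - by apply: (integrable_bounded (M := 1) G) => // s; rewrite normr1.
  by move=> s _; have /andP[] := block_moment_01 b jk.1 jk.2 s a0.
have MD0 G jk : 0 <= M G jk * D%:R.
  by have /andP[M0 _] := M01 G jk; rewrite mulr_ge0.
have MD G jk : (Num.truncn (M G jk * D%:R) < D.+1)%N.
  have /andP[_ M1] := M01 G jk.
  rewrite truncn_lt_nat// (@le_lt_trans _ _ D%:R) ?ltr_nat//.
  by rewrite ler_piMl.
exists {ffun I -> 'I_D.+1}, (fun G => [ffun jk => Ordinal (MD G jk)]).
split.
  move=> G G' G1 G'1 GG' m x.
  rewrite (mixture_densityE m x a0 G1) (mixture_densityE m x a0 G'1).
  set e := a^-1 * expR (- (3 * p)%:R).
  have := @Rintegral_near_combination _ I G G' (scale_kernel a b m x)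
    (fun jk => block_moment a b jk.1 jk.2) (block_coef a m x) a^-1 e D%:R^-1
    (a^-1 * expR (27 * p)%:R).
  move=> /(_ (measurable_scale_kernel b m x a0)) H.
  apply: le_trans (H _ _ _ _ _ _) _.
  - by move=> s; rewrite ger0_norm ?scale_kernel_ge0 ?scale_kernel_le.
  - by move=> jk; exact: measurable_block_moment.
  - by move=> jk s; exact: block_moment_01.
  - by move=> s; exact: scale_kernel_near_combination.
  - by move=> jk; exact: block_coef_le.
  - move=> jk; rewrite -/(M G jk) -/(M G' jk).
    have /ffunP/(_ jk) := GG'; rewrite !ffunE => /(congr1 val)/= uv.
    have := rounding_lt1 (MD0 G jk) (MD0 G' jk) uv.
    rewrite -mulrBl normrM [`|D%:R|]ger0_norm// -ltr_pdivlMr// mul1r.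
    exact: ltW.
  rewrite cardI (_ : 3 * e = e + e + e); last by lra.
  have T0 : 0 < (3 ^ (30 * p))%:R :> R by rewrite ltr0n expn_gt0.
  have NR0 : 0 < N%:R :> R by rewrite ltr0n.
  have -> : N%:R * (a^-1 * expR (27 * p)%:R * D%:R^-1) =
      a^-1 * (expR (27 * p)%:R / (3 ^ (30 * p))%:R) :> R.
    have -> : D%:R = N%:R * (3 ^ (30 * p))%:R :> R by rewrite natrM.
    by field; rewrite !lt0r_neq0.
  rewrite lerD2l.
  rewrite ler_wpM2l ?invr_ge0 ?(ltW a0)// ler_pdivrMr ?ltr0n ?expn_gt0//.
  rewrite -ler_pdivrMl ?expR_gt0// -expRN opprK -expRD natrX.
  rewrite (_ : _ + _ = (30 * p)%:R * 1); last by rewrite !natrM; lra.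
  by rewrite expRM_natl lerXn2r ?nnegrE ?expR_ge0 ?expR1_le3.
rewrite card_ffun card_ord cardI.
have DN : (D.+1 <= 3 ^ (37 * p))%N.
  have p3 : (p <= 3 ^ p)%N by exact/ltnW/ltn_expl.
  have c3 : (168 <= 3 ^ (5 * p))%N.
    by apply: (@leq_trans (3 ^ 5)) => //; rewrite leq_exp2l// leq_pmulr.
  have D1 : (D.+1 <= 2 * D)%N by rewrite mul2n -addnn -addn1 leq_add2l.
  apply: (leq_trans D1); rewrite /D /N.
  rewrite (_ : 2 * _ = 168 * (p * p) * 3 ^ (30 * p))%N; last by ring.
  rewrite (_ : 37 * p = 5 * p + (p + p) + 30 * p)%N; last by ring.
  rewrite (expnD 3 (5 * p + (p + p))) (expnD 3 (5 * p)) (expnD 3 p p).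
  by apply: leq_mul => //; apply: leq_mul => //; exact: leq_mul.
apply: (@le_trans _ _ ((3 ^ (37 * p)) ^ N)%:R).
  by rewrite ler_nat leq_exp2r.
rewrite -expnM natrX (@le_trans _ _ (expR 2 ^+ (37 * p * N)))//.
  by rewrite lerXn2r ?nnegrE ?expR_ge0// three_le.
rewrite -expRM_natl ler_expR /N !natrM.
by rewrite le_eqVlt; apply/orP; left; apply/eqP; ring.
Qed.

Let two_mixtures G a b m m' x (B : R) : 0 < a -> G `[a, b]%classic = 1%E ->
  (forall s, `|scale_kernel a b m x s - scale_kernel a b m' x s| <= B) ->
  mixture_density m' G x <= mixture_density m G x + B.
Proof.
move=> a0 G1 kB.
rewrite (mixture_densityE m x a0 G1) (mixture_densityE m' x a0 G1).
have im := integrable_scale_kernel G b m x a0.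
have im' := integrable_scale_kernel G b m' x a0.
rewrite -lerBlDl -RintegralB// -[leRHS](Rintegral_probability_cst G); apply: le_Rintegral => //.
- apply: (integrable_bounded (M := a^-1 + a^-1) G).
    by apply: measurable_funB; exact: measurable_scale_kernel.
  move=> s; apply: (le_trans (ler_normB _ _)); apply: lerD;
    by rewrite ger0_norm ?scale_kernel_ge0 ?scale_kernel_le.
- by apply: (integrable_bounded (M := `|B|) G).
move=> s _; have := kB s; rewrite distrC => H.
exact: le_trans (ler_norm _) H.
Qed.

Let far_mixture G a b mu m x (r : R) : 0 < a -> G `[a, b]%classic = 1%E ->
  0 < r -> r <= `|m - mu| ->
  mixture_density m G x <= (1 + `|x - mu| / a) / r.
Proof.
move=> a0 G1 r0 rm; rewrite (mixture_densityE m x a0 G1).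
set B := (_ / r).
rewrite -[leRHS](Rintegral_probability_cst G); apply: le_Rintegral => //.
- exact: integrable_scale_kernel.
- by apply: (integrable_bounded (M := `|B|) G).
move=> s _; rewrite /B ler_pdivlMr//.
apply: le_trans (scale_kernel_tail b m mu x s a0).
by rewrite ler_wpM2l// scale_kernel_ge0.
Qed.

Let location_code (mu r eta : R) : 0 < r -> 0 < eta ->
  exists loc : R -> option 'I_(Num.truncn (2 * r / eta)).+1,
    forall m m', loc m = loc m' ->
    (r <= `|m - mu| /\ r <= `|m' - mu|) \/ `|m - m'| <= eta.
Proof.
move=> r0 eta0; pose cell m := Num.truncn ((m - mu + r) / eta).
have near_ge0 m : `|m - mu| < r -> 0 <= (m - mu + r) / eta.
  by rewrite ltr_norml => /andP[h _]; apply: divr_ge0; lra.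
have cell_lt m : `|m - mu| < r -> (cell m < (Num.truncn (2 * r / eta)).+1)%N.
  move=> mr; rewrite ltnS; apply: le_truncn; rewrite ler_pM2r ?invr_gt0//.
  by move: mr; rewrite ltr_norml => /andP[_ h]; lra.
exists (fun m => if `|m - mu| < r then Some (inord (cell m)) else None) => m m'.
have [mr|mr] := ltP `|m - mu| r; have [m'r|m'r] := ltP `|m' - mu| r => //.
  move=> [/(congr1 val)/=]; rewrite !inordK ?cell_lt// => cellE; right.
  have := rounding_lt1 (near_ge0 m mr) (near_ge0 m' m'r) cellE.
  rewrite -mulrBl (_ : m - mu + r - (m' - mu + r) = m - m'); last by ring.
  by rewrite normrM [`|eta^-1|]gtr0_norm ?invr_gt0// ltr_pdivrMr// mul1r => /ltW.
by left.
Qed.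

Let location_cells a b tau : 0 < a -> a <= b -> 0 < tau ->
  (Num.truncn (2 * (b / tau) / (a * tau / 4)))%:R <= 8 * (b / (a * tau)) ^+ 2.
Proof.
move=> a0 ab t0; have b0 : 0 < b by exact: lt_le_trans ab.
have re0 : 0 <= 2 * (b / tau) / (a * tau / 4).
  by rewrite !(divr_ge0, mulr_ge0)// ltW.
have /andP[Al _] := truncn_itv re0; apply: (le_trans Al).
rewrite (_ : 2 * (b / tau) / (a * tau / 4) =
  8 * ((b / (a * tau)) * tau^-1)); last by field; rewrite !lt0r_neq0.
rewrite ler_wpM2l// expr2; apply: ler_wpM2l.
  by rewrite divr_ge0 ?mulr_ge0// ltW.
by rewrite invfM mulrA ler_peMl ?invr_ge0 ?(ltW t0)// ler_pdivlMr// mul1r.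
Qed.

(** Locations at distance at least [b / tau] from [mu] need no separation: the
    mixture is then below the tolerance, which is allowed to grow linearly in
    [`|x - mu|]. The other locations are rounded to a grid of step
    [a * tau / 4]. *)
Lemma mixture_code a b mu tau : 0 < a -> a <= b -> 0 < tau -> tau <= 1 ->
  exists (J : finType) (code : R -> probability R R -> J),
    (forall m m' G G', G `[a, b]%classic = 1%E -> G' `[a, b]%classic = 1%E ->
       code m G = code m' G' -> forall x,
       mixture_density m' G' x <=
       mixture_density m G x + tau / a * (1 + `|x - mu| / b)) /\
    #|J|%:R <= expR (6222 * (2 * (1 + ln (b / (a * tau)))) ^+ 3) :> R.
Proof.
move=> a0 ab t0 t1; have b0 : 0 < b by exact: lt_le_trans ab.
have at0 : 0 < a * tau by rewrite mulr_gt0.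
have bat1 : 1 <= b / (a * tau).
  by rewrite ler_pdivlMr// mul1r (le_trans _ ab)// ler_piMr// ltW.
have expLam : expR (ln (b / (a * tau))) = b / (a * tau).
  by rewrite lnK// posrE divr_gt0.
have lnba : ln (b / a) <= ln (b / (a * tau)).
  rewrite ler_ln ?posrE ?divr_gt0// ler_pM2l// lef_pV2 ?posrE//.
  by rewrite ler_piMr// ltW.
have := ln_ge0 bat1; move: (ln (b / (a * tau))) expLam lnba => l expl lnba l0.
pose p := (Num.truncn (1 + l)).+1.
have lp : 1 + l < p%:R by exact: truncnS_gt.
have pl : p%:R <= 2 * (1 + l).
  have l10 : 0 <= 1 + l by rewrite addr_ge0.
  by have /andP[+ _] := truncn_itv l10; rewrite /p -natr1; lra.
have p0 : (0 < p)%N by [].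
have p1 : 1 <= p%:R :> R by rewrite ler1n.
clearbody p.
have small : 3 * (a^-1 * expR (- (3 * p)%:R)) <= tau / a / 2.
  rewrite mulrCA (_ : tau / a / 2 = a^-1 * (tau / 2)); last by ring.
  apply: ler_wpM2l; first by rewrite invr_ge0 ltW.
  have h1 : expR (- (3 * p)%:R) <= expR (- l) * expR (- 3%:R).
    by rewrite -expRD ler_expR natrM; lra.
  have h2 : expR (- l) <= tau.
    rewrite expRN expl invf_div ler_pdivrMr// mulrC.
    by apply: ler_wpM2l => //; exact: ltW.
  have h3 : expR (- 3%:R) <= 8^-1 :> R.
    rewrite expRN lef_pV2 ?posrE ?expR_gt0// -[3%:R]mulr1 expRM_natl.
    by rewrite (_ : 8 = 2 ^+ 3 :> R) ?lerXn2r// ?nnegrE ?expR_ge0// -natrX.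
  have h4 : expR (- l) * expR (- 3%:R) <= tau * 8^-1.
    by apply: ler_pM => //; exact: expR_ge0.
  lra.
have {}lnba : ln (b / a) < p%:R by lra.
have [J [code [codeP cardJ]]] := moment_code a0 p0 lnba.
have r0 : 0 < b / tau by rewrite divr_gt0.
have eta0 : 0 < a * tau / 4 by rewrite divr_gt0.
have [loc locP] := location_code mu r0 eta0.
have Ale := location_cells a0 ab t0.
move: (Num.truncn _) loc locP Ale => A loc locP Ale.
pose J' : finType := (option 'I_A.+1 * J)%type.
exists J', (fun m G => (loc m, code G)); split.
  move=> m m' G G' G1 G'1 [/locP locE codeE] x.
  have tail0 : 0 <= `|x - mu| / b by rewrite divr_ge0// ltW.
  have ta0 : 0 <= tau / a by rewrite divr_ge0// ltW.
  case: locE => [[_ far']|near].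
    apply: (le_trans (far_mixture x a0 G'1 r0 far')).
    rewrite ler_wpDl ?(mixture_density_ge0 _ _ a0 G1)//.
    rewrite invf_div (_ : tau / a * _ = (b / a + `|x - mu| / a) * (tau / b)).
      apply: ler_wpM2r; first by rewrite divr_ge0 ?ltW.
      by rewrite lerD2r ler_pdivlMr// mul1r.
    by field; rewrite !lt0r_neq0.
  have shift : mixture_density m' G' x <= mixture_density m G' x + tau / a / 2.
    apply: (two_mixtures a0 G'1) => s.
    apply: (le_trans (scale_kernel_shift b m m' x s a0)).
    rewrite ler_pdivrMr ?exprn_gt0//.
    rewrite (_ : tau / a / 2 * a ^+ 2 = 2 * (a * tau / 4)); last first.
      by field; exact: lt0r_neq0.
    exact: ler_wpM2l.
  have close : mixture_density m G' x <= mixture_density m G x + tau / a / 2.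
    have := le_trans (codeP _ _ G1 G'1 codeE m x) small.
    by rewrite distrC => /(le_trans (ler_norm _)); rewrite lerBlDl.
  apply: (le_trans shift); rewrite -lerBrDr; apply: (le_trans close).
  rewrite -addrA lerD2l -[leRHS]addrC addrC -lerBlDr opprK -splitr.
  by rewrite ler_peMr// lerDl.
rewrite card_prod card_option card_ord natrM.
apply: (@le_trans _ _ (expR (6 * p%:R ^+ 3) * expR (6216 * p%:R ^+ 3))).
  apply: ler_pM => //; rewrite -natr1 -natr1.
  have e4 : 16 <= expR 4 :> R.
    rewrite (_ : 4 = 4%:R * 1 :> R); last by rewrite mulr1.
    rewrite expRM_natl (_ : 16 = 2 ^+ 4 :> R); last by rewrite -natrX.
    by rewrite lerXn2r// nnegrE ?expR_ge0.
  rewrite -expl -expRM_natl in Ale.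
  have p3 : p%:R <= p%:R ^+ 3 :> R.
    by rewrite -{1}[p%:R]expr1; apply: ler_weXn2l.
  have E1 : 1 <= expR (2%:R * l) by rewrite -[leLHS]expR0 ler_expR mulr_ge0.
  have E2 : expR 4 * expR (2%:R * l) <= expR (6 * p%:R ^+ 3).
    by rewrite -expRD ler_expR; lra.
  apply: le_trans E2; apply: (@le_trans _ _ (16 * expR (2%:R * l))); first lra.
  by rewrite ler_wpM2r ?expR_ge0.
rewrite -expRD ler_expR -mulrDl (_ : 6 + 6216 = 6222); last by lra.
apply: ler_wpM2l; first exact: ler0n.
by apply: lerXn2r => //; rewrite nnegrE ?ler0n ?mulr_ge0 ?addr_ge0.
Qed.

End codes.

(** * Concentration of the likelihood *)

Section maximum_likelihood.
Context d (T : measurableType d) (R : realType) (P : probability T R).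
Variables (n : nat) (a b mu : R) (sigma : 'I_n.+1 -> R).
Variable X : 'I_n.+1 -> {RV P >-> R}.
Hypotheses (a0 : 0 < a) (ab : a <= b).
Hypothesis sigma_ab : forall i, a <= sigma i <= b.
Hypothesis indep : mutually_independent X.
Hypothesis normalX : forall i, normally_distributed (X i) mu (sigma i).

Let f := mixture_density mu (empirical_measure sigma).
Let p i := normal_pdf mu (sigma i).

Let f_avg : f = fun x => n.+1%:R^-1 * \sum_(i < n.+1) p i x.
Proof. by apply/funext => x; rewrite /f (mixture_density_empirical _ _ a0 sigma_ab). Qed.

Let G1 := empirical_probability_itv sigma_ab.

Let b0 : 0 < b. Proof. exact: lt_le_trans ab. Qed.

Let sigma_gt0 i : 0 < sigma i.
Proof. by have /andP[+ _] := sigma_ab i; exact: lt_le_trans. Qed.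

Let mf : measurable_fun setT f.
Proof. exact: measurable_mixture_density G1. Qed.

Let f_gt0 x : 0 < f x.
Proof. exact: mixture_density_gt0 G1. Qed.

Let int_f : (\int[lebesgue_measure]_x (f x)%:E = 1)%E.
Proof. exact: integral_mixture_density G1. Qed.

Let mp i : measurable_fun setT (p i).
Proof. exact: measurable_normal_pdf. Qed.

Let p0 i x : 0 <= p i x.
Proof. exact: normal_pdf_ge0. Qed.

Let density i (B : set R) : measurable B ->
  (P (X i @^-1` B) = \int[lebesgue_measure]_(x in B) (p i x)%:E)%E.
Proof. by move=> mB; exact: normalX. Qed.

(** With this tolerance the envelope below contributes at most [n.+1%:R^-1] to
    an affinity, hence a bounded factor to its [n.+1]-st power. *)
Let tau := a / (36 * n.+1%:R ^+ 4 * b).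

Let tau_gt0 : 0 < tau.
Proof. by rewrite divr_gt0// !mulr_gt0// exprn_gt0. Qed.

Let envelope x := tau / a * (1 + `|x - mu| / b).

Let envelope_ge0 x : 0 <= envelope x.
Proof.
apply: mulr_ge0; first by apply: divr_ge0; exact: ltW.
by apply: addr_ge0 => //; apply: divr_ge0 => //; exact: ltW.
Qed.

Let measurable_envelope : measurable_fun setT envelope.
Proof.
apply: measurable_funM => //; apply: measurable_funD => //.
apply: measurable_funM => //; apply: measurableT_comp => //.
exact: measurable_funB.
Qed.

Let affinity_envelope :
  (\int[lebesgue_measure]_x (Num.sqrt (envelope x * f x))%:E <=
   (n.+1%:R^-1)%:E)%E.
Proof.
rewrite f_avg; apply: le_trans (integral_sqrt_envelope_le _ _ _) _.
- by rewrite divr_ge0 ?(ltW a0) ?(ltW tau_gt0).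
- by move=> i; rewrite sigma_gt0/=; have /andP[] := sigma_ab i.
have : 0 < n.+1%:R :> R by [].
rewrite lee_fin /tau; move: (n.+1%:R : R) => N N0.
have -> : a / (36 * N ^+ 4 * b) / a * b = (6 * N ^+ 2)^-1 ^+ 2.
  by field; rewrite !lt0r_neq0.
rewrite sqrtr_sqr gtr0_norm ?invr_gt0 ?mulr_gt0 ?exprn_gt0//.
by rewrite le_eqVlt; apply/orP; left; apply/eqP; field; rewrite lt0r_neq0.
Qed.

(** By [affinity_le] a large Hellinger distance makes the affinity small, and
    [1 - t / 2 + n.+1%:R^-1 <= expR (n.+1%:R^-1 - t / 2)]. *)
Lemma bad_mixture_probability m (G : probability R R) t :
  G `[a, b]%classic = 1%E ->
  (t%:E <= hellinger2 (mixture_density m G) f)%E ->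
  (P [set w | (\prod_(i < n.+1) f (X i w) <=
      \prod_(i < n.+1) (mixture_density m G (X i w) + envelope (X i w)))%R]
   <= (expR (1 - n.+1%:R * t / 2))%:E)%E.
Proof.
move=> hG; set h := mixture_density m G => ht.
have mh : measurable_fun setT h by exact: measurable_mixture_density hG.
have h0 x : 0 <= h x by exact: mixture_density_ge0 hG.
have int_h : (\int[lebesgue_measure]_x (h x)%:E = 1)%E.
  exact: integral_mixture_density hG.
pose A : R := 1 - t / 2 + n.+1%:R^-1.
have mhe : measurable_fun setT (fun x => h x + envelope x).
  exact: measurable_funD.
have msqrt (g : R -> R) : measurable_fun setT g ->
    measurable_fun setT (fun x => (Num.sqrt (g x * f x))%:E).
  by move=> mg; apply/measurable_EFinP/measurable_sqrt; exact: measurable_funM.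
have IA : (\int[lebesgue_measure]_x (Num.sqrt ((h x + envelope x) * f x))%:E <=
    A%:E)%E.
  apply: (@le_trans _ _ (\int[lebesgue_measure]_x
      ((Num.sqrt (h x * f x))%:E + (Num.sqrt (envelope x * f x))%:E))%E).
    apply: ge0_le_integral => //=.
    - exact: (msqrt _ mhe).
    - by apply: emeasurable_funD; exact: msqrt.
    move=> x _; rewrite -EFinD lee_fin mulrDl.
    by apply: sqrtrD_le; apply: mulr_ge0 => //; exact: ltW.
  rewrite ge0_integralD//=; last 2 first.
  - exact: msqrt.
  - exact: msqrt.
  rewrite /A EFinD; apply: leeD; last exact: affinity_envelope.
  by apply: affinity_le => //; [move=> x; exact: ltW|rewrite int_h|rewrite int_f].
have A0 : 0 <= A.
  rewrite -lee_fin; apply: le_trans IA.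
  by apply: integral_ge0 => x _; rewrite lee_fin sqrtr_ge0.
have H := @likelihood_le_probability _ _ _ P n X p indep mp p0 density
  (fun x => h x + envelope x) mhe.
have /H{}H : forall x, 0 <= h x + envelope x.
  by move=> x; rewrite addr_ge0.
have favg0 x : 0 < n.+1%:R^-1 * \sum_(i < n.+1) p i x.
  by have := f_gt0 x; rewrite f_avg.
rewrite f_avg in IA *.
have {}H := H favg0 A IA.
apply: (le_trans H); rewrite lee_fin.
apply: (@le_trans _ _ (expR (n.+1%:R^-1 - t / 2) ^+ n.+1)).
  rewrite lerXn2r ?nnegrE ?expR_ge0//.
  have := expR_ge1Dx (n.+1%:R^-1 - t / 2); rewrite /A; apply: le_trans.
  by rewrite addrA addrAC.
by rewrite -expRM_natl mulrBr mulfV ?pnatr_eq0// mulrA lexx.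
Qed.

(** A union bound over the codes. Mixtures with the same code are
    interchangeable up to the envelope, so for each code one mixture at squared
    Hellinger distance larger than [t] stands for all of them. The event [A] is
    measurable although [m] and [G] may depend on the observations in any way. *)
Lemma likelihood_concentration t : exists A : set T,
  [/\ measurable A,
     (P A <= (expR (6222 * (2 * (1 + ln (b / (a * tau)))) ^+ 3 +
                    (1 - n.+1%:R * t / 2)))%:E)%E &
     forall m (G : probability R R) w, G `[a, b]%classic = 1%E ->
       (t%:E < hellinger2 (mixture_density m G) f)%E ->
       \prod_(i < n.+1) f (X i w) <=
       \prod_(i < n.+1) mixture_density m G (X i w) -> A w].
Proof.
have tau_le1 : tau <= 1.
  rewrite /tau ler_pdivrMr ?mulr_gt0 ?exprn_gt0// mul1r (le_trans ab)//.
  rewrite ler_peMl ?(ltW b0)// mulr_ege1 ?exprn_ege1 ?ler1n//.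
have [J [code [codeP cardJ]]] := mixture_code mu a0 ab tau_gt0 tau_le1.
move: (6222 * _) cardJ => K cardJ.
pose eps : R := expR (1 - n.+1%:R * t / 2).
have /choice[E HE] (j : J) : exists E : set T, [/\ measurable E,
    (P E <= eps%:E)%E &
    forall m (G : probability R R) w, G `[a, b]%classic = 1%E ->
       (t%:E < hellinger2 (mixture_density m G) f)%E -> code m G = j ->
       \prod_(i < n.+1) f (X i w) <=
       \prod_(i < n.+1) mixture_density m G (X i w) -> E w].
  have [[[m0 G0] /= [hG0 ht0 cj]]|none] := pselect (exists mG : R * probability R R,
      [/\ mG.2 `[a, b]%classic = 1%E,
       (t%:E < hellinger2 (mixture_density mG.1 mG.2) f)%E &
       code mG.1 mG.2 = j]); last first.
    exists set0; split => //; first by rewrite measure0 lee_fin expR_ge0.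
    by move=> m G w hG ht cj; exfalso; apply: none; exists (m, G).
  exists [set w | \prod_(i < n.+1) f (X i w) <=
    \prod_(i < n.+1) (mixture_density m0 G0 (X i w) + envelope (X i w))].
  split.
  - have mg : measurable_fun setT (fun x => mixture_density m0 G0 x + envelope x).
      by apply: measurable_funD => //; exact: measurable_mixture_density hG0.
    by rewrite f_avg; exact: (@measurable_likelihood_le _ _ _ P n X p mp _ mg).
  - exact: bad_mixture_probability (ltW ht0).
  move=> m G w hG ht cj' /= /le_trans; apply; apply: ler_prod => i _.
  rewrite (mixture_density_ge0 _ _ a0 hG)/=.
  by apply: codeP => //; rewrite cj cj'.
exists (\big[setU/set0]_(j : J) E j).
have [mU PU] : measurable (\big[setU/set0]_(j : J) E j) /\
    (P (\big[setU/set0]_(j : J) E j) <= (#|J|%:R * eps)%:E)%E.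
  suff [mU PU] : measurable (\big[setU/set0]_(j : J) E j) /\
      (P (\big[setU/set0]_(j : J) E j) <= \sum_(j : J) eps%:E)%E.
    by split=> //; rewrite mulr_natl -sumr_const -sumEFin.
  elim/big_rec2 : _ => [|j A e _ [mA PA]]; first by rewrite measure0.
  have [mE PE _] := HE j; split; first exact: measurableU.
  by apply: le_trans (measureU2 _ mE mA) _; exact: leeD.
split=> //.
  by apply: (le_trans PU); rewrite lee_fin expRD ler_wpM2r ?expR_ge0.
move=> m G w hG ht lik; rewrite (bigD1 (code m G))//=; left.
by have [_ _] := HE (code m G); apply; [exact: hG|exact: ht| |exact: lik].
Qed.

End maximum_likelihood.

(** * The maximum likelihood estimator *)

Section joint_mle.
Context {R : realType}.
Implicit Types (a b m : R).

Lemma prod_le_sum_ln (I : finType) (F H : I -> R) :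
  (forall i, 0 < F i) -> (forall i, 0 < H i) ->
  \sum_i ln (F i) <= \sum_i ln (H i) -> \prod_i F i <= \prod_i H i.
Proof.
move=> F0 H0 FH.
have expK (K : I -> R) : (forall i, 0 < K i) ->
    \prod_i K i = expR (\sum_i ln (K i)).
  by move=> K0; rewrite expR_sum; apply: eq_bigr => i _; rewrite lnK ?posrE.
by rewrite (expK F)// (expK H)// ler_expR.
Qed.

Lemma joint_mle_likelihood n (sigma : 'I_n.+1 -> R) a b mu (x : 'I_n.+1 -> R)
    m (G : probability R R) :
  0 < a -> a <= b -> (forall i, a <= sigma i <= b) -> is_joint_mle a b x m G ->
  G `[a, b]%classic = 1%E /\
  \prod_(i < n.+1) mixture_density mu (empirical_measure sigma) (x i) <=
  \prod_(i < n.+1) mixture_density m G (x i).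
Proof.
move=> a0 ab sab [/topological_support_itvP G1 best]; split=> //.
have E1 := empirical_probability_itv sab.
have /(best mu (empirical_probability sigma)) :
    topological_support (empirical_probability sigma) `<=` `[a, b]%classic.
  exact/topological_support_itvP.
rewrite /log_likelihood ler_pM2l ?invr_gt0//; apply: prod_le_sum_ln => i.
  exact: mixture_density_gt0 E1.
exact: mixture_density_gt0 G1.
Qed.

(** A tolerance that is polynomial in [a / b] and in [n.+1^-1] costs a constant
    factor only on the logarithmic scale. *)
Lemma tolerance_le n a b : 0 < a -> a <= b ->
  0 <= 1 + ln (b / (a * (a / (36 * n.+1%:R ^+ 4 * b)))) <=
  11 * Num.max 1 (ln (n.+1%:R * b / a)).
Proof.
move=> a0 ab; have b0 : 0 < b by exact: lt_le_trans ab.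
set Q := n.+1%:R * b / a.
have ba1 : 1 <= b / a by rewrite ler_pdivlMr// mul1r.
have n1 : 1 <= n.+1%:R :> R by rewrite ler1n.
have Q0 : 0 < Q by rewrite /Q divr_gt0 ?mulr_gt0.
have -> : b / (a * (a / (36 * n.+1%:R ^+ 4 * b))) =
    36 * (n.+1%:R ^+ 4 * (b / a) ^+ 2).
  have : 0 < n.+1%:R :> R by [].
  by move: (n.+1%:R : R) => N N0; field; rewrite !lt0r_neq0.
have B1 : 1 <= 36 * (n.+1%:R ^+ 4 * (b / a) ^+ 2).
  by apply: mulr_ege1; [rewrite ler1n|apply: mulr_ege1; exact: exprn_ege1].
have B0 : 0 < 36 * (n.+1%:R ^+ 4 * (b / a) ^+ 2) by exact: lt_le_trans B1.
have le36 : 36 * (n.+1%:R ^+ 4 * (b / a) ^+ 2) <= expR 6 * Q ^+ 4.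
  have e6 : 36 <= expR 6 :> R.
    rewrite (_ : 6 = 6%:R * 1 :> R); last by rewrite mulr1.
    rewrite expRM_natl (@le_trans _ _ (2 ^+ 6))//.
      by rewrite -natrX ler_nat.
    rewrite lerXn2r ?nnegrE ?expR_ge0//.
    by have := expR_ge1Dx (1 : R); lra.
  apply: ler_pM => //.
    by rewrite mulr_ge0// exprn_ge0// divr_ge0 ?ltW.
  rewrite /Q -mulrA [leRHS]exprMn ler_wpM2l ?exprn_ge0//.
  by rewrite ler_weXn2l.
have lnle : ln (36 * (n.+1%:R ^+ 4 * (b / a) ^+ 2)) <= 6 + 4 * ln Q.
  apply: (@le_trans _ _ (ln (expR 6 * Q ^+ 4))).
    by rewrite ler_ln ?posrE// mulr_gt0 ?expR_gt0 ?exprn_gt0.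
  rewrite lnM ?posrE ?expR_gt0 ?exprn_gt0// expRK lnXn// lerD2l.
  by rewrite mulr_natl.
have L1 : 1 <= Num.max 1 (ln Q) by rewrite le_max lexx.
have L2 : ln Q <= Num.max 1 (ln Q) by rewrite le_max lexx orbT.
by rewrite addr_ge0 ?ln_ge0//=; lra.
Qed.

Lemma exponent_le (K L3 M q u : R) : 0 <= K -> 1 <= L3 -> 0 <= q ->
  L3 + q <= M -> u <= K * L3 -> u + (1 - (K + 1) * M) <= - q.
Proof.
move=> K0 L1 q0 LM uK; have : K * L3 <= K * M by rewrite ler_wpM2l//; lra.
lra.
Qed.

End joint_mle.

Theorem theorem1p1 (R : realType) :
  exists C C' : R, 0 < C /\ 0 < C' /\
  forall (d : measure_display) (T : measurableType d) (P : probability T R)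
    (n : nat) (smin smax mu : R) (sigma : 'I_n -> R)
    (X : 'I_n -> {RV P >-> R}) (muhat : T -> R) (Ghat : T -> probability R R),
  (1 <= n)%N ->
  0 < smin -> smin <= smax ->
  (forall i, smin <= sigma i <= smax) ->
  mutually_independent X ->
  (forall i, normally_distributed (X i) mu (sigma i)) ->
  (forall w, is_joint_mle smin smax (fun i => X i w) (muhat w) (Ghat w)) ->
  forall delta : R, 0 < delta < 1 ->
  let L := Num.max 1 (ln (n%:R * smax / smin)) in
  let LL := Num.max 1 (ln (ln (n%:R * smax / smin))) in
  holds_with_probability_ge P
    [set w | (`|muhat w - mu|%:E <=
      C%:E * hellinger_modulus (empirical_measure sigma)
        (C' / n%:R * (L ^+ 3 * LL ^+ 4 + ln delta^-1)))%E]
    (1 - delta).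
Proof.
have [K [K0 Kle]] : exists K : R, 0 <= K /\ forall l L : R, 0 <= l ->
    l <= 11 * L -> 6222 * (2 * l) ^+ 3 <= K * L ^+ 3.
  exists (6222 * 22 ^+ 3); split.
    by apply: mulr_ge0; [exact: ler0n|apply: exprn_ge0; exact: ler0n].
  move=> l L l0 lL; rewrite -mulrA -exprMn; apply: ler_wpM2l; first exact: ler0n.
  by apply: lerXn2r; rewrite ?nnegrE; lra.
(* the modulus is taken at [4 * t], and [n * t / 2] must exceed the logarithm of
   the number of codes by [1 + ln delta^-1] *)
exists 1, (8 * (K + 1)); do 2 (split; first by lra).
move=> d T P [//|n] a b mu sigma X muhat Ghat _ a0 ab sab indep normalX mle.
move=> delta /andP[d0 d1] L LL.
set M := L ^+ 3 * LL ^+ 4 + ln delta^-1.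
have L1 : 1 <= L by rewrite le_max lexx.
have LL1 : 1 <= LL by rewrite le_max lexx.
have tol := tolerance_le n a0 ab.
pose t := 2 * (K + 1) / n.+1%:R * M.
have exponent : 6222 * (2 * (1 + ln (b / (a * (a / (36 * n.+1%:R ^+ 4 * b)))))) ^+ 3
    + (1 - n.+1%:R * t / 2) <= ln delta.
  have /andP[/Kle l0 /l0 lL] := tol.
  have -> : n.+1%:R * t / 2 = (K + 1) * M.
    rewrite /t; have : 0 < n.+1%:R :> R by [].
    by move: (n.+1%:R : R) => N N0; field; exact: lt0r_neq0.
  have lnd : 0 <= ln delta^-1 by rewrite ln_ge0// invf_ge1// ltW.
  have dE : ln delta = - ln delta^-1 by rewrite lnV ?posrE// opprK.
  rewrite dE; apply: exponent_le lL => //.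
    exact: exprn_ege1.
  by rewrite lerD2r ler_peMr ?exprn_ege1// exprn_ge0// (le_trans _ L1).
have [A [mA PA AP]] := likelihood_concentration a0 ab sab indep normalX t.
have PAd : (P A <= delta%:E)%E.
  by apply: (le_trans PA); rewrite lee_fin -[leRHS]lnK ?posrE// ler_expR.
have E1 := empirical_probability_itv sab.
exists (~` A); split.
- exact: measurableC.
- move=> w nAw /=; have [G1 lik] := joint_mle_likelihood mu a0 ab sab (mle w).
  rewrite mul1e (_ : 8 * (K + 1) / n.+1%:R * M = 4 * t); last first.
    by rewrite /t; ring.
  apply: location_le_hellinger_modulus.
  + by move=> m; exact: measurable_mixture_density E1.
  + exact: measurable_mixture_density G1.
  rewrite leNgt; apply/negP => far.
  by apply: nAw; exact: AP far lik.
rewrite probability_setC// EFinB; apply: leeB => //.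
Qed.
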